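(* Let $p,q\geq 0$ with $m=p+q$, consider $\mathrm{PO}(p,q)<\mathrm{PGL}_m\mathbb{R}$, and let $\mathrm{O}'$ be the conjugacy limit of $\mathrm{PO}(p,q)$ via a sequence $[b_n]\in\mathrm{PGL}_m\mathbb{R}$ as $n\to\infty$. Then the Lie algebra $\mathfrak{o}'$ of $\mathrm{O}'$ is isomorphic to the Lie algebra obtained from $\mathfrak{po}(p,q)$ by a composition of finitely many contractions, i.e. there are Lie algebras $\mathfrak{h}_0=\mathfrak{po}(p,q),\mathfrak{h}_1,\dots,\mathfrak{h}_s$ such that each $\mathfrak{h}_{l+1}$ is the contraction of $\mathfrak{h}_l$ along some Lie subalgebra $\mathfrak{t}_l\subset\mathfrak{h}_l$, and $\mathfrak{h}_s\cong\mathfrak{o}'$.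
   Context: $\mathrm{O}(p,q)$ is the group of real $m\times m$ matrices preserving the quadratic form $-x_1^2-\dots-x_p^2+x_{p+1}^2+\dots+x_{p+q}^2$; $\mathrm{PO}(p,q)$ is its image in $\mathrm{PGL}_m\mathbb{R}$ (matrices modulo nonzero scalars). The Lie algebra $\mathfrak{pgl}_m\mathbb{R}$ consists of real $m\times m$ matrices modulo real multiples of the identity (identified with $\mathfrak{sl}_m\mathbb{R}$ via trace-zero representatives); $\mathfrak{po}(p,q)$ is the Lie algebra of $\mathrm{PO}(p,q)$. A sequence of closed subgroups $H_n<\mathrm{PGL}_m\mathbb{R}$ converges geometrically to a closed subgroup $L$ if every element of $L$ is the limit of some sequence $h_n\in H_n$ and every accumulation point of every sequence $h_n\in H_n$ lies in $L$; the conjugacy limit of $H$ via $[b_n]$ is the geometric limit of $[b_n]H[b_n]^{-1}$. Contraction: for a Lie algebra $\mathfrak{h}$ with bracket $[\cdot,\cdot]$, a Lie subalgebra $\mathfrak{t}$ and a complementary vector subspace $\mathfrak{t}^c$ (so every $X$ is uniquely $X_{\mathfrak{t}}+X_{\mathfrak{t}^c}$), set $\phi_\varepsilon(X)=X_{\mathfrak{t}}+\varepsilon X_{\mathfrak{t}^c}$ for $\varepsilon>0$; the contraction of $\mathfrak{h}$ along $\mathfrak{t}$ is the underlying vector space of $\mathfrak{h}$ with the bracket $[X,Y]'=\lim_{\varepsilon\to0}\phi_\varepsilon^{-1}([\phi_\varepsilon(X),\phi_\varepsilon(Y)])$. *)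

(* Defs.v *)
From HB Require Import structures.
From mathcomp Require Import all_boot all_order all_algebra.
From mathcomp Require Import all_classical all_reals all_analysis.
Set Implicit Arguments. Unset Strict Implicit. Unset Printing Implicit Defensive.
Import Order.TTheory GRing.Theory Num.Theory.
Import numFieldNormedType.Exports.
Local Open Scope classical_set_scope.
Local Open Scope ring_scope.

Section Defs.
Variables (R : realType) (m : nat).
Notation M := 'M[R]_m.

Definition expm (X : M) : M :=
  lim (series (fun k : nat => (k`!%:R)^-1 *: X ^+ k) @ \oo).

Definition Jpq (p : nat) : M :=
  \matrix_(i, j) (if i == j then (if (i < p)%N then -1 else 1) else 0).

Definition Opq (p : nat) : set M := [set A | A^T *m Jpq p *m A = Jpq p].

(** Subsets of PGL_m(R) are represented by their full preimages in GL_m(R):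
    sets of invertible matrices closed under multiplication by nonzero
    scalars. *)
Definition pgl_set (S : set M) : Prop :=
  (forall A, S A -> A \in unitmx) /\
  (forall A (c : R), S A -> c != 0 -> S (c *: A)).

(** PO(p,q) = image of O(p,q) in PGL_m(R) (as a saturated set). *)
Definition POpq (p : nat) : set M :=
  [set A | exists c : R, c != 0 /\ Opq p (c *: A)].

Definition conjset (b : M) (S : set M) : set M :=
  [set b *m A *m invmx b | A in S].

(** Convergence [A_n] -> [A] in PGL_m(R) (quotient topology of GL_m/R^* ). *)
Definition pgl_cvg (u : nat -> M) (A : M) : Prop :=
  A \in unitmx /\
  exists c : nat -> R, (forall n, c n != 0) /\
    ((fun n => c n *: u n) @ \oo --> A).

Definition geom_cvg (H : nat -> set M) (L : set M) : Prop :=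
  (forall A, L A -> exists h : nat -> M, (forall n, H n (h n)) /\ pgl_cvg h A) /\
  (forall (h : nat -> M), (forall n, H n (h n)) ->
     forall A, (exists sigma : nat -> nat, (forall n, (sigma n < sigma n.+1)%N) /\
                 pgl_cvg (h \o sigma) A) -> L A).

(** Lie algebra (in pgl_m R = sl_m R, trace-zero representatives) of a closed
    subgroup L of PGL_m(R) given as a saturated set of matrices. *)
Definition lie_alg (L : set M) : set M :=
  [set X | \tr X = 0 /\ forall t : R, L (expm (t *: X))].

Definition comm (X Y : M) : M := X * Y - Y * X.

Definition subspace (V : set M) : Prop :=
  V 0 /\ (forall X Y, V X -> V Y -> V (X + Y)) /\
  (forall (a : R) X, V X -> V (a *: X)).

Definition lie_subalg (V : set M) (br : M -> M -> M) (t : set M) : Prop :=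
  subspace t /\ t `<=` V /\ (forall X Y, t X -> t Y -> t (br X Y)).

Definition lie_contraction (V : set M) (br : M -> M -> M) (t : set M)
    (br' : M -> M -> M) : Prop :=
  exists (tc : set M) (pt ptc : M -> M),
    subspace tc /\ tc `<=` V /\ (forall X, t X -> tc X -> X = 0) /\
    (forall X, V X -> [/\ t (pt X), tc (ptc X) & X = pt X + ptc X]) /\
    let phi (e : R) X := pt X + e *: ptc X in
    let phiinv (e : R) X := pt X + e^-1 *: ptc X in
    forall X Y, V X -> V Y ->
      (fun e : R => phiinv e (br (phi e X) (phi e Y))) @ 0^'+ --> br' X Y.

Definition lie_iso_comm (V : set M) (br : M -> M -> M) (W : set M) : Prop :=
  exists f : M -> M,
    (forall (a : R) X Y, f (a *: X + Y) = a *: f X + f Y) /\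
    (forall X, V X -> W (f X)) /\
    (forall X Y, V X -> V Y -> f X = f Y -> X = Y) /\
    (forall Z, W Z -> exists X, V X /\ f X = Z) /\
    (forall X Y, V X -> V Y -> f (br X Y) = comm (f X) (f Y)).

End Defs.

(* Main.v *)
(** Writing the conjugates of PO(p,q) as the similitude groups of the forms
    S_n = b_n^-T J b_n^-1, the spectral theorem and compactness give, along a
    subsequence, S_n = Q_n^T diag(eps_i e_i(n)) Q_n with Q_n convergent to an
    invertible matrix, constant signs eps_i, and for all i, j either
    e_i = e_j or one of e_i, e_j negligible with respect to the other; this
    defines a total preorder on the indices.
    A similitude B of a diagonal form d satisfies
      d_i B_ij adj(B)_kk = d_j adj(B)_ji B_kk,
    a relation from which the similitude factor has disappeared. It passes to
    the limit, and differentiating it along exp(tX) gives the linear equations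
    of the Lie algebra of the limit group; conversely, a solution of these
    equations is a limit of elements of the Lie algebras of the S_n, and exp is
    continuous.
    For the contractions, cut the preorder at each index l and contract along
    the matrices that are block diagonal for this cut. Starting from the
    commutator, each contraction removes from
      [X,Y]_ij = sum_k X_ik Y_kj - Y_ik X_kj
    the terms where the cut separates k from both i and j. After all the cuts
    only the k between i and j remain, and then keeping the entries (i,j) with
    i below j is an isomorphism onto the limit algebra. *)

Require Import Defs.
From HB Require Import structures.
From mathcomp Require Import all_boot all_order all_algebra.
From mathcomp Require Import all_classical all_reals all_analysis.
From mathcomp Require Import ring lra.
Import Order.TTheory GRing.Theory Num.Theory.
Import numFieldNormedType.Exports.
Set Implicit Arguments. Unset Strict Implicit. Unset Printing Implicit Defensive.
Local Open Scope classical_set_scope.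
Local Open Scope ring_scope.

(** * The matrix exponential *)

Lemma cvg_mxP (R : realType) m n T (F : set_system T) {FF : Filter F}
    (f : T -> 'M[R]_(m, n)) (A : 'M[R]_(m, n)) :
  f @ F --> A <-> forall i j, f x i j @[x --> F] --> A i j.
Proof.
split=> [fA i j|fA].
  apply: (cvg_comp _ (fun M : 'M[R]_(m, n) => M i j) fA).
  exact: coord_continuous.
apply/cvg_ballP => e e0.
have : \forall x \near F, forall ij : 'I_m * 'I_n, ball (A ij.1 ij.2) e (f x ij.1 ij.2).
  by apply: filter_forall => -[i j] /=; move/cvg_ballP : (fA i j); exact.
by apply: filterS => x Px; split=> // i j; exact: (Px (i, j)).
Qed.

Lemma cvg_sum_fin (R : realType) T (F : set_system T) {FF : Filter F}
    (I : Type) (r : seq I) (P : pred I) (f : I -> T -> R) (a : I -> R) :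
  (forall i, f i x @[x --> F] --> a i) ->
  \sum_(i <- r | P i) f i x @[x --> F] --> \sum_(i <- r | P i) a i.
Proof. by move=> fa; apply: cvg_big => //; exact: add_continuous. Qed.

Lemma cvg_prod_fin (R : realType) T (F : set_system T) {FF : Filter F}
    (I : Type) (r : seq I) (P : pred I) (f : I -> T -> R) (a : I -> R) :
  (forall i, f i x @[x --> F] --> a i) ->
  \prod_(i <- r | P i) f i x @[x --> F] --> \prod_(i <- r | P i) a i.
Proof. by move=> fa; apply: cvg_big => //; exact: mul_continuous. Qed.

Lemma cvg_mulmx (R : realType) m n p T (F : set_system T) {FF : Filter F}
    (f : T -> 'M[R]_(m, n)) (g : T -> 'M[R]_(n, p)) (A : 'M[R]_(m, n)) (B : 'M[R]_(n, p)) :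
  f @ F --> A -> g @ F --> B -> f x *m g x @[x --> F] --> A *m B.
Proof.
move=> /cvg_mxP fA /cvg_mxP gB; apply/cvg_mxP => i j; rewrite mxE.
under eq_fun do rewrite mxE.
by apply: cvg_sum_fin => k; apply: cvgM.
Qed.

Lemma cvg_trmx (R : realType) m n T (F : set_system T) {FF : Filter F}
    (f : T -> 'M[R]_(m, n)) (A : 'M[R]_(m, n)) :
  f @ F --> A -> (f x)^T @[x --> F] --> A^T.
Proof.
move=> /cvg_mxP fA; apply/cvg_mxP => i j; rewrite mxE.
by under eq_fun do rewrite mxE; exact: fA.
Qed.

Lemma cvg_det (R : realType) n T (F : set_system T) {FF : Filter F}
    (f : T -> 'M[R]_n) (A : 'M[R]_n) :
  f @ F --> A -> \det (f x) @[x --> F] --> \det A.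
Proof.
move=> /cvg_mxP fA; apply: cvg_sum_fin => s; apply: cvgM; first exact: cvg_cst.
by apply: cvg_prod_fin => i; exact: fA.
Qed.

Lemma cvg_adj (R : realType) n T (F : set_system T) {FF : Filter F}
    (f : T -> 'M[R]_n) (A : 'M[R]_n) :
  f @ F --> A -> \adj (f x) @[x --> F] --> \adj A.
Proof.
move=> /cvg_mxP fA; apply/cvg_mxP => i j; rewrite mxE.
under eq_fun do rewrite mxE.
apply: cvgM; first exact: cvg_cst.
apply: cvg_det; apply/cvg_mxP => k l; rewrite !mxE.
by under eq_fun do rewrite !mxE; exact: fA.
Qed.

Section exp.
Variables (R : realType) (m : nat).
Implicit Types X Y Z : 'M[R]_m.

(** The entrywise l^1 norm: it dominates every row sum, and as a finite sum of entries it is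
    continuous for entrywise convergence. *)
Definition absum X : R := \sum_i \sum_j `|X i j|.

Lemma absum_ge0 X : 0 <= absum X.
Proof. by apply: sumr_ge0 => i _; apply: sumr_ge0. Qed.

Lemma row_absum X i : \sum_j `|X i j| <= absum X.
Proof.
by rewrite /absum [leRHS](bigD1 i)//= lerDl; apply: sumr_ge0 => k _; apply: sumr_ge0.
Qed.

Lemma mulmx_entry_le X Y a i j :
  (forall k, `|Y k j| <= a) -> `|(X * Y) i j| <= absum X * a.
Proof.
move=> Ya; have a0 : 0 <= a by apply: le_trans (Ya j).
rewrite mxE (le_trans (ler_norm_sum _ _ _))//.
apply: le_trans (_ : (\sum_k `|X i k|) * a <= _); last first.
  by rewrite ler_wpM2r// row_absum.
by rewrite mulr_suml ler_sum// => k _; rewrite normrM ler_wpM2l.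
Qed.

Lemma expmx_entry_le X k i j : `|(X ^+ k) i j| <= absum X ^+ k.
Proof.
elim: k i j => [|k IH] i j.
  by rewrite !expr0 mxE; case: eqP; rewrite ?normr1 ?normr0.
by rewrite !exprS; apply: mulmx_entry_le => l; exact: IH.
Qed.

(** The matrix form of the mean value bound for the k-th power, by telescoping X^(k+1) - Y^(k+1) = X
    (X^k - Y^k) + (X - Y) Y^k. At k = 0 the truncated exponent is harmless, being multiplied by
    0. *)
Lemma expmx_sub_le X Y C k i j : absum X <= C -> absum Y <= C ->
  `|(X ^+ k - Y ^+ k) i j| <= absum (X - Y) * (C ^+ k.-1 *+ k).
Proof.
move=> XC YC; have C0 : 0 <= C by apply: le_trans XC; exact: absum_ge0.
have d0 := absum_ge0 (X - Y).
elim: k i j => [|k IH] i j; first by rewrite subrr mxE normr0 mulr0.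
have -> : X ^+ k.+1 - Y ^+ k.+1 = X * (X ^+ k - Y ^+ k) + (X - Y) * Y ^+ k.
  by rewrite !exprS mulrBr mulrBl addrA subrK.
rewrite mxE (le_trans (ler_normD _ _))// /= [leRHS]mulrnAr mulrSr lerD//.
  rewrite -mulrnAr; apply: le_trans (@mulmx_entry_le X _ _ i j (IH^~ j)) _.
  rewrite mulrCA ler_wpM2l//; case: k {IH} => [|k]; first by rewrite !mulr0n mulr0.
  by rewrite mulrnAr /= exprS lerMn2r ler_wpM2r// exprn_ge0.
apply: mulmx_entry_le => l; apply: le_trans (expmx_entry_le Y k l j) _.
by rewrite lerXn2r ?nnegrE// absum_ge0.
Qed.

Lemma exprZmx (a : R) X k : (a *: X) ^+ k = a ^+ k *: X ^+ k.
Proof.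
elim: k => [|k IH]; first by rewrite !expr0 scale1r.
by rewrite !exprS IH -!mulmxE -scalemxAl -scalemxAr scalerA.
Qed.

Lemma series_mxE (u : nat -> 'M[R]_m) i j :
  (fun n => (series u n) i j) = series (fun k => u k i j).
Proof. by apply/funext => n; rewrite /series/= summxE. Qed.

Lemma is_cvg_expm_entry X i j :
  cvgn (series (fun k => (k`!%:R)^-1 * (X ^+ k) i j)).
Proof.
apply: normed_cvg; apply: series_le_cvg (is_cvg_series_exp_coeff (absum X)).
- by move=> n; exact: normr_ge0.
- by move=> n; rewrite /exp_coeff/= divr_ge0// exprn_ge0// absum_ge0.
move=> n; rewrite /exp_coeff/= normrM ger0_norm ?invr_ge0// mulrC.
by rewrite ler_wpM2r ?invr_ge0// expmx_entry_le.
Qed.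

(** [expm] is a [lim], hence a default value unless the series converges; each entry is dominated by
    the scalar exponential series at [absum X]. *)
Lemma cvg_expm X : series (fun k => (k`!%:R)^-1 *: X ^+ k) @ \oo --> expm X.
Proof.
suff: cvgn (series (fun k => (k`!%:R)^-1 *: X ^+ k)) by [].
apply/cvg_ex; exists (\matrix_(i, j)
   limn (series (fun k => (k`!%:R)^-1 * (X ^+ k) i j))).
apply/cvg_mxP => i j; rewrite mxE series_mxE.
by under eq_fun do rewrite mxE; exact: is_cvg_expm_entry.
Qed.

Lemma cvg_expm_entry X i j :
  series (fun k => (k`!%:R)^-1 * (X ^+ k) i j) @ \oo --> expm X i j.
Proof.
have /cvg_mxP/(_ i j) := @cvg_expm X; rewrite series_mxE.
by under eq_fun do rewrite mxE.
Qed.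

Lemma expm0 : expm 0 = 1 :> 'M[R]_m.
Proof.
apply/matrixP => i j; apply: (cvg_unique _ (@cvg_expm_entry 0 i j)) => //.
apply: cvg_near_cst; near=> n.
have -> : n = n.-1.+1 by rewrite prednK//; near: n; exact: nbhs_infty_gt.
rewrite /series/= big_nat_recl// expr0 fact0 invr1 mul1r big1 ?addr0// => k _.
by rewrite expr0n/= mxE mulr0.
Unshelve. all: by end_near. Qed.

Lemma expm_tr X : expm X^T = (expm X)^T.
Proof.
apply/matrixP => i j; rewrite mxE.
apply: (cvg_unique _ (@cvg_expm_entry _ i j)) => //.
have -> : (fun k => (k`!%:R)^-1 * (X^T ^+ k) i j) =
          (fun k => (k`!%:R)^-1 * (X ^+ k) j i).
  apply/funext => k; congr (_ * _).
  have -> : X^T ^+ k = (X ^+ k)^T; last by rewrite mxE.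
  elim: k => [|k IH]; first by rewrite !expr0 trmx1.
  by rewrite exprSr exprS IH -!mulmxE trmx_mul.
exact: cvg_expm_entry.
Qed.

Lemma expm_conj (P Q X : 'M[R]_m) : P *m Q = 1%:M ->
  expm (P *m X *m Q) = P *m expm X *m Q.
Proof.
move=> PQ; have QP : Q *m P = 1%:M by exact: mulmx1C.
apply: (cvg_unique _ (@cvg_expm _)) => //.
have -> : series (fun k => (k`!%:R)^-1 *: (P *m X *m Q) ^+ k) =
  (fun n => P *m series (fun k => (k`!%:R)^-1 *: X ^+ k) n *m Q).
  apply/funext => n; rewrite /series/= mulmx_sumr mulmx_suml.
  apply: eq_bigr => k _; rewrite -scalemxAr -scalemxAl; congr (_ *: _).
  elim: k => [|k IH]; first by rewrite !expr0 mulmx1.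
  by rewrite !exprS IH -!mulmxE !mulmxA -(mulmxA _ Q P) QP mulmx1.
apply: cvg_mulmx; last exact: cvg_cst.
by apply: cvg_mulmx; [exact: cvg_cst|exact: cvg_expm].
Qed.

(** An entry of exp(sX) is a scalar power series in s, and its formal derivative replaces X^k by X
    X^k. *)
Lemma is_derive_expm_entry X i j (t : R) :
  is_derive t (1 : R) (fun s => expm (s *: X) i j) ((X * expm (t *: X)) i j).
Proof.
pose c k : R := (k`!%:R)^-1 * (X ^+ k) i j.
have cE Y s : (fun k => (k`!%:R)^-1 * (Y * X ^+ k) i j * s ^+ k) =
     (fun k => (k`!%:R)^-1 * (Y * (s *: X) ^+ k) i j).
  apply/funext => k; rewrite exprZmx -mulmxE -scalemxAr mulmxE.
  by rewrite [X in _ = _ * X]mxE -mulrA [_ * s ^+ k]mulrC.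
(* Taken at Y = 1, X and X X, this gives the series and its first two formal derivatives. *)
have cvgY Y s :
  pseries (fun k => (k`!%:R)^-1 * (Y * X ^+ k) i j) s @ \oo -->
    (Y * expm (s *: X)) i j.
  rewrite /pseries cE.
  have <- : (fun n => (Y *m series (fun k => (k`!%:R)^-1 *: (s *: X) ^+ k) n) i j)
      = series (fun k => (k`!%:R)^-1 * (Y * (s *: X) ^+ k) i j).
    apply/funext => n; rewrite /series/= mulmx_sumr summxE.
    by apply: eq_bigr => k _; rewrite -scalemxAr mxE.
  apply: (iffLR (cvg_mxP _ _)).
  by apply: cvg_mulmx; [exact: cvg_cst|exact: cvg_expm].
have c1E : c = (fun k => (k`!%:R)^-1 * (1 * X ^+ k) i j).
  by apply/funext => k; rewrite mul1r.
have facS k : k.+1%:R * (k.+1`!%:R)^-1 = (k`!%:R)^-1 :> R.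
  by rewrite factS natrM invfM mulrA divff ?mul1r// pnatr_eq0.
have c2E : pseries_diffs c = (fun k => (k`!%:R)^-1 * (X * X ^+ k) i j).
  by apply/funext => k; rewrite /pseries_diffs /c mulrA facS exprS.
have c3E : pseries_diffs (pseries_diffs c) =
    (fun k => (k`!%:R)^-1 * (X * X * X ^+ k) i j).
  by apply/funext => k; rewrite c2E /pseries_diffs mulrA facS exprS mulrA.
have -> : (fun s => expm (s *: X) i j) = (fun s => limn (pseries c s)).
  apply/funext => s; apply/esym/cvg_lim => //.
  by rewrite c1E -[expm _]mul1r; exact: cvgY.
have -> : (X * expm (t *: X)) i j = limn (pseries (pseries_diffs c) t).
  by apply/esym/cvg_lim => //; rewrite c2E; exact: cvgY.
(* Termwise differentiation at t asks for convergence at some point of larger absolute value. *)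
apply: (@pseries_snd_diffs _ c (`|t| + 1) t).
- by rewrite c1E; apply/cvg_ex; eexists; exact: cvgY.
- by rewrite c2E; apply/cvg_ex; eexists; exact: cvgY.
- by rewrite c3E; apply/cvg_ex; eexists; exact: cvgY.
by rewrite (ger0_norm (addr_ge0 _ _))// ltrDl.
Qed.


Lemma is_derive_mulmx (F G : R -> 'M[R]_m) (F' G' : 'M[R]_m) (t : R) :
  (forall i j, is_derive t (1 : R) (fun s => F s i j) (F' i j)) ->
  (forall i j, is_derive t (1 : R) (fun s => G s i j) (G' i j)) ->
  forall i j, is_derive t (1 : R) (fun s => (F s * G s) i j)
    ((F' * G t + F t * G') i j).
Proof.
move=> dF dG i j.
have -> : (fun s => (F s * G s) i j) =
    \sum_k ((fun s => F s i k) * (fun s => G s k j)).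
  by apply/funext => s; rewrite mxE fct_sumE.
apply: is_derive_eq (is_derive_sum (fun k => is_deriveM (dF i k) (dG k j))) _.
rewrite !mxE -big_split; apply: eq_bigr => k _ /=.
by rewrite addrC [G t k j *: _]mulrC.
Qed.

(** The derivative of exp(sY) N exp(sX) is exp(sY) (YN + NX) exp(sX) = 0, so the product keeps its
    value at s = 0. With N = 1 this yields inverses, with N a form and Y = X^T isometries. *)
Lemma expm_intertwine X Y (N : 'M[R]_m) (t : R) : Y * N + N * X = 0 ->
  expm (t *: Y) * N * expm (t *: X) = N.
Proof.
move=> YNX; apply/matrixP => i j.
have -> : N i j = (expm (0 *: Y) * N * expm (0 *: X)) i j.
  by rewrite !scale0r !expm0 mulr1 mul1r.
apply: (@is_derive_0_is_cst _
  (fun s => (expm (s *: Y) * N * expm (s *: X)) i j)) => s.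
have dY k l : is_derive s (1 : R) (fun s => expm (s *: Y) k l)
    ((expm (s *: Y) * Y) k l).
  (* Transposition moves the factor produced by differentiation from the left to the right of the
     exponential. *)
  have := is_derive_expm_entry Y^T l k s.
  have trE r : expm (r *: Y^T) = (expm (r *: Y))^T.
    by rewrite -expm_tr; congr expm; apply/matrixP => ? ?; rewrite !mxE.
  rewrite (_ : (fun r => _) = (fun r => expm (r *: Y) k l)); last first.
    by apply/funext => r; rewrite trE mxE.
  by rewrite trE -mulmxE -trmx_mul mxE.
have dN k l : is_derive s (1 : R) (fun s => (N : 'M[R]_m) k l) ((0 : 'M[R]_m) k l).
  by rewrite mxE; exact: is_derive_cst.
apply: is_derive_eq (is_derive_mulmx (is_derive_mulmx dY dN)
  (fun k l => is_derive_expm_entry X k l s) i j) _.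
rewrite mulr0 addr0 -!mulrA (mulrA Y) (mulrA N) -mulrDr -mulrDl YNX.
by rewrite mul0r mulr0 mxE.
Qed.

Lemma expmN_mul X (t : R) : expm ((- t) *: X) * expm (t *: X) = 1.
Proof.
have := @expm_intertwine X (- X) 1 t.
rewrite mulr1 mul1r addNr mulr1 scalerN scaleNr; exact.
Qed.

Lemma invmx_expm X (t : R) : 
  expm (t *: X) \in unitmx /\ invmx (expm (t *: X)) = expm ((- t) *: X).
Proof.
have XX : expm ((- t) *: X) *m expm (t *: X) = 1%:M := expmN_mul X t.
have [_ uX] := mulmx1_unit XX; split=> //.
by rewrite -[LHS]mul1mx -XX mulmxK.
Qed.

(** Sum [expmx_sub_le] over k: since k C^(k-1) / k! = C^(k-1) / (k-1)!, the bounds add up to at most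
    [expR C]. *)
Lemma expm_lipschitz X Y C i j : absum X <= C -> absum Y <= C ->
  `|expm X i j - expm Y i j| <= absum (X - Y) * expR C.
Proof.
move=> XC YC; have C0 : 0 <= C by apply: le_trans XC; exact: absum_ge0.
pose S Z n := series (fun k => (k`!%:R)^-1 * (Z ^+ k) i j) n.
have cv : `|S X n - S Y n| @[n --> \oo] --> `|expm X i j - expm Y i j|.
  by apply: cvg_norm; apply: cvgB; exact: cvg_expm_entry.
rewrite -(cvg_lim _ cv)//; apply: limr_le; first by apply/cvg_ex; eexists; exact: cv.
near=> n; rewrite /S /series/= -sumrB.
have nC : \sum_(0 <= k < n) exp_coeff C k <= expR C.
  apply: (@nondecreasing_cvgn_le _ (series (exp_coeff C))) (is_cvg_series_exp_coeff C) _.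
  apply: nondecreasing_series => k _ _; rewrite /exp_coeff/=.
  by rewrite divr_ge0 ?exprn_ge0.
rewrite (le_trans (ler_norm_sum _ _ _))//.
apply: le_trans (ler_wpM2l (absum_ge0 _) nC).
have -> : n = n.-1.+1 by rewrite prednK//; near: n; exact: nbhs_infty_gt.
rewrite big_nat_recl// !expr0 subrr normr0 add0r.
rewrite mulr_sumr [leRHS]big_nat_recr//= -[leLHS]addr0 lerD//; last first.
  by rewrite mulr_ge0 ?absum_ge0// /exp_coeff/= divr_ge0// exprn_ge0.
apply: ler_sum => k _.
have /= := expmx_sub_le k.+1 i j XC YC.
rewrite !mxE => H.
rewrite -mulrBr normrM ger0_norm ?invr_ge0// mulrC ler_pdivrMr ?ltr0n ?fact_gt0//.
apply: le_trans H _.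
rewrite -mulrA ler_wpM2l ?absum_ge0// /exp_coeff/= factS natrM.
by rewrite [_.+1%:R * _]mulrC mulrA mulfVK ?mulr_natr// pnatr_eq0 -lt0n fact_gt0.
Unshelve. all: by end_near. Qed.

Lemma cvg_absum (X : nat -> 'M[R]_m) (Y : 'M[R]_m) :
  X @ \oo --> Y -> absum (X n) @[n --> \oo] --> absum Y.
Proof.
move=> XY; do 2!apply: cvg_sum_fin => ?; apply: cvg_norm.
exact: (iffLR (cvg_mxP _ _)).
Qed.

Lemma cvg_expm_seq (X : nat -> 'M[R]_m) (Y : 'M[R]_m) :
  X @ \oo --> Y -> expm (X n) @[n --> \oo] --> expm Y.
Proof.
move=> XY; have absum0 : absum (0 : 'M[R]_m) = 0.
  by rewrite /absum big1// => i _; rewrite big1// => j _; rewrite mxE normr0.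
have dist0 : absum (X n - Y) * expR (absum Y + 1) @[n --> \oo] --> 0.
  rewrite -[0](mul0r (expR (absum Y + 1))) -{1}absum0 -(subrr Y).
  by apply: cvgM; [apply: cvg_absum; apply: cvgB XY (cvg_cst _)|exact: cvg_cst].
apply/cvg_mxP => i j; apply/cvgrPdist_le => e e0; near=> n.
rewrite distrC (le_trans (@expm_lipschitz _ _ (absum Y + 1) _ _ _ _))//.
- by near: n; apply: cvgr_le (cvg_absum XY) _ _; rewrite ltrDl.
- by rewrite lerDl.
- by near: n; apply: cvgr_le dist0 _ e0.
Unshelve. all: by end_near. Qed.

(** Differentiation at t = 0, where the exponential is the identity; the diagonal entries at k
    survive only when i = j. *)
Lemma expm_rel_derive (X : 'M[R]_m) (rho : R) i j k :
  (forall t : R, expm (t *: X) i j * expm ((- t) *: X) k k =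
     rho * (expm ((- t) *: X) j i * expm (t *: X) k k)) ->
  X i j - (i == j)%:R * X k k = rho * ((i == j)%:R * X k k - X j i).
Proof.
move=> H.
have dP a b : is_derive (0 : R) (1 : R) (fun s => expm (s *: X) a b) (X a b).
  by have := is_derive_expm_entry X a b 0; rewrite scale0r expm0 mulr1.
have dN a b : is_derive (0 : R) (1 : R) (fun s => expm ((- s) *: X) a b) (- X a b).
  have := is_derive_expm_entry (- X) a b 0; rewrite scale0r expm0 mulr1 mxE.
  by under eq_fun do rewrite scalerN -scaleNr.
have d1 := is_deriveM (dP i j) (dN k k).
have d2 := is_deriveZ rho (is_deriveM (dN j i) (dP k k)).
have E : (fun s => expm (s *: X) i j) * (fun s => expm ((- s) *: X) k k) =
  rho \*: ((fun s => expm ((- s) *: X) j i) * (fun s => expm (s *: X) k k)).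
  by apply/funext => s; exact: H.
rewrite E in d1.
have := @derive_val _ _ _ _ _ _ _ d1; rewrite (@derive_val _ _ _ _ _ _ _ d2).
rewrite oppr0 scale0r expm0 !mxE eqxx (eq_sym j) /GRing.scale/= !mul1r => ->.
by rewrite mulrN addrC.
Qed.
End exp.

(** * Diagonalization of symmetric matrices *)

Lemma cvg_subsequence (T : topologicalType) (u : nat -> T) (a : T) (sigma : nat -> nat) :
  (forall n, (sigma n < sigma n.+1)%N) -> u @ \oo --> a -> (u \o sigma) @ \oo --> a.
Proof.
move=> sinc ua; apply: cvg_comp ua.
have le_sigma n : (n <= sigma n)%N.
  by elim: n => // n IH; apply: leq_ltn_trans IH (sinc n).
move=> A [N _ NA]; exists N => // n /= Nn; apply: NA => /=.
exact: leq_trans Nn (le_sigma n).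
Qed.

(** Extract successively, one coordinate at a time; coordinates already convergent stay so along
    further subsequences. *)
Lemma bolzano_weierstrass_fin (R : realType) (I : finType) (u : nat -> I -> R) (C : R) :
  (forall k i, `|u k i| <= C) ->
  exists sigma : nat -> nat, (forall k, (sigma k < sigma k.+1)%N) /\
    exists a : I -> R, forall i, u (sigma k) i @[k --> \oo] --> a i.
Proof.
move=> uC.
have [sigma [sinc scv]] : exists sigma : nat -> nat,
    (forall k, (sigma k < sigma k.+1)%N) /\
    forall i, i \in enum I -> cvgn (fun k => u (sigma k) i).
  elim: (enum I) => [|i s [sigma [sinc IH]]]; first by exists id.
  have [|f finc fcv] := @bolzano_weierstrass R (fun k => u (sigma k) i).
    exists C; split; first exact: num_real.
    by move=> x Cx k _; apply: le_trans (uC _ _) (ltW Cx).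
  have fS k : (f k < f k.+1)%N by exact: ((increasing_seqP f).2 finc k).
  exists (sigma \o f); split.
    by move=> k /=; exact: (homo_ltn ltn_trans sinc (fS k)).
  move=> i'; rewrite inE => /orP[/eqP ->//|/IH/= /cvg_ex[l cl]].
  by apply/cvg_ex; exists l; exact: (cvg_subsequence fS cl).
exists sigma; split=> //; exists (fun i => limn (fun k => u (sigma k) i)).
by move=> i; apply: scv; rewrite mem_enum.
Qed.

Section spectral.
Variables (R : realType) (m : nat).
Implicit Types (K S : 'M[R]_m).

Lemma orthogonal_entry_le K i j : K^T *m K = 1%:M -> `|K i j| <= 1.
Proof.
move=> /matrixP/(_ j j); rewrite !mxE eqxx mulr1n => K1.
rewrite -(@ler_pXn2r _ 2)// ?nnegrE// expr1n real_normK ?num_real// -K1.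
rewrite [leRHS](bigD1 i)//= mxE -expr2 lerDl; apply: sumr_ge0 => k _.
by rewrite mxE -expr2 sqr_ge0.
Qed.

Lemma cvg_mxtrace (f : nat -> 'M[R]_m) (A : 'M[R]_m) :
  f @ \oo --> A -> \tr (f n) @[n --> \oo] --> \tr A.
Proof. by move=> /cvg_mxP fA; apply: cvg_sum_fin => i; exact: fA. Qed.

(** Compactness of O(m): the entries of a maximizing sequence lie in [-1, 1], so a subsequence
    converges, and the orthogonality relation passes to the limit. *)
Lemma orthogonal_max (f : 'M[R]_m -> R) (B : R) :
  (forall (K : nat -> 'M[R]_m) L, K @ \oo --> L -> f (K n) @[n --> \oo] --> f L) ->
  (forall K, K^T *m K = 1%:M -> f K <= B) ->
  exists2 K, K^T *m K = 1%:M & forall L, L^T *m L = 1%:M -> f L <= f K.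
Proof.
move=> fcont fB; pose E := [set f K | K in [set K : 'M[R]_m | K^T *m K = 1%:M]].
have E1 : E (f 1%:M) by exists 1%:M => //=; rewrite trmx1 mulmx1.
have supE : has_sup E.
  by split; [exists (f 1%:M)|exists B => _ [K KK <-]; exact: fB].
have /choice[K KP] : forall n : nat, exists K,
    K^T *m K = 1%:M /\ sup E - n.+1%:R^-1 < f K.
  move=> n; have [//|_ [K KK <-] ?] := @sup_adherent _ E n.+1%:R^-1 _ supE.
  by exists K.
have [|sigma [sinc [l Kl]]] :=
    @bolzano_weierstrass_fin _ ('I_m * 'I_m)%type (fun n ij => K n ij.1 ij.2) 1.
  by move=> n ij; apply: orthogonal_entry_le; have [] := KP n.
pose L : 'M[R]_m := \matrix_(i, j) l (i, j).
have KL : K (sigma n) @[n --> \oo] --> L.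
  by apply/cvg_mxP => i j; rewrite mxE; exact: (Kl (i, j)).
exists L.
  apply: (cvg_unique _ (cvg_mulmx (cvg_trmx KL) KL)) => //.
  by rewrite (_ : (fun n => _) = cst 1%:M); [exact: cvg_cst|apply/funext => n; exact: (KP _).1].
move=> L' L'L'; apply: (@le_trans _ _ (sup E)).
  by apply: ub_le_sup; [exact: supE.2|exists L'].
have c1 : sup E - (sigma n).+1%:R^-1 @[n --> \oo] --> sup E.
  rewrite -[X in _ --> X]subr0; apply: cvgB; first exact: cvg_cst.
  exact: (@cvg_subsequence _ (fun n => n.+1%:R^-1 : R) 0 sigma sinc (@cvg_harmonic R)).
apply: (ler_cvg_to c1 (fcont _ _ KL)).
by apply: nearW => n; apply: ltW; exact: (KP _).2.
Qed.

(* At a maximum K of tr(W K^T S K) over O(m), with W diagonal with distinct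
   entries and B = K^T S K, the derivative along K exp(tA) with A = [W, B],
   which is skew-symmetric, is tr(A^2) = - sum A_ij^2; hence A = 0, and B is
   diagonal. *)
Lemma symmetric_diag S : S^T = S ->
  exists K, K^T *m K = 1%:M /\ is_diag_mx (K^T *m S *m K).
Proof.
move=> Ssym; pose W : 'M[R]_m := diag_mx (\row_i i%:R).
have WT : W^T = W by rewrite tr_diag_mx.
pose f K := \tr (W *m (K^T *m S *m K)).
have [K KK Kmax] : exists2 K, K^T *m K = 1%:M &
    forall L, L^T *m L = 1%:M -> f L <= f K.
  (* A crude bound suffices: it only has to be uniform over O(m). *)
  apply: (@orthogonal_max _ (\sum_(i < m) (absum W * (\sum_(j < m) \sum_(k < m) 1 * (absum S * 1))))).
    move=> K L KL; apply: cvg_mxtrace; apply: cvg_mulmx; first exact: cvg_cst.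
    by apply: cvg_mulmx => //; apply: cvg_mulmx (cvg_trmx KL) (cvg_cst _).
  move=> K KK; apply: ler_sum => i _; apply: le_trans (ler_norm _) _.
  apply: mulmx_entry_le => k; rewrite -mulmxA.
  apply: (@le_trans _ _ (absum K^T * (absum S * 1))).
    by do 2!apply: mulmx_entry_le => ?; exact: orthogonal_entry_le.
  rewrite {1}/absum mulr_suml; apply: ler_sum => a _.
  rewrite mulr_suml; apply: ler_sum => c _.
  rewrite ler_wpM2r// ?mulr1 ?absum_ge0// mxE.
  exact: orthogonal_entry_le.
exists K; split=> //.
have [B BE] : exists B, B = K^T *m S *m K by eexists.
rewrite -BE; have BT : B^T = B by rewrite BE !trmx_mul trmxK Ssym mulmxA.
have [A AE] : exists A, A = W *m B - B *m W by eexists.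
have AT : A^T = - A by rewrite AE linearB/= !trmx_mul WT BT opprB.
pose g t := \tr (W * (expm (t *: A^T) * B * expm (t *: A))).
have gE t : g t = f (K *m expm (t *: A)).
  rewrite /f /g trmx_mul -expm_tr BE -!mulmxE !mulmxA.
  by rewrite (_ : (t *: A)^T = t *: A^T)//; apply/matrixP => ? ?; rewrite !mxE.
(* As A is skew, K exp(tA) stays orthogonal, so g is maximal at t = 0. *)
have gmax t : g t <= g 0.
  rewrite !gE scale0r expm0 mulmx1; apply: Kmax.
  have := @expm_intertwine _ _ A A^T 1 t.
  rewrite mulr1 mul1r AT addNr => /(_ erefl).
  rewrite trmx_mul mulmxA -(mulmxA _ K^T) KK mulmx1 -expm_tr.
  rewrite mulr1 -AT -mulmxE => H.
  by rewrite (_ : (t *: A)^T = t *: A^T)//; apply/matrixP => ? ?; rewrite !mxE.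
have dc (N : 'M[R]_m) t k l : is_derive t (1 : R) (fun s => N k l) ((0 : 'M[R]_m) k l).
  by rewrite mxE; exact: is_derive_cst.
have dg t := is_derive_sum (fun i : 'I_m => is_derive_mulmx (dc W t) 
  (is_derive_mulmx (is_derive_mulmx (fun k l => is_derive_expm_entry A^T k l t) (dc B t))
     (fun k l => is_derive_expm_entry A k l t)) i i).
have gS : g = \sum_(i < m) (fun t => (W * (expm (t *: A^T) * B * expm (t *: A))) i i).
  by apply/funext => t; rewrite fct_sumE.
rewrite -gS in dg.
have dg0 := dg 0.
have : is_derive (0 : R) (1 : R) g 0.
  apply: (@derive1_at_max _ g (-1) 1 0).
  - by rewrite (le_trans (lerN10 _)) ?ler01.
  - by move=> t _; exact: (@ex_derive _ _ _ _ _ _ _ (dg t)).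
  - by rewrite in_itv/= ltrN10 ltr01.
  - by move=> t _; exact: gmax.
move=> /(@derive_val _ _ _ _ _ _ _); rewrite (@derive_val _ _ _ _ _ _ _ dg0).
rewrite !scale0r !expm0 !(mul0r, add0r, mulr1, mul1r, mulr0, addr0) AT => trA.
(* Cyclicity of the trace turns tr(W (BA - AB)) into tr((WB - BW) A). *)
have {trA} : \tr (A *m A) = 0.
  rewrite -[RHS]trA -[RHS]/(\tr (W *m (- A *m B + B *m A))) {1}AE.
  rewrite mulmxBl mulNmx mulmxDr mulmxN !mxtraceD !raddfN/= addrC.
  congr (- _ + _); last by rewrite mulmxA.
  by rewrite -mulmxA mxtrace_mulC -mulmxA.
have ANE i k : A k i = - A i k by have /matrixP/(_ i k) := AT; rewrite !mxE.
move=> trA; have A0 i k : A i k = 0.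
  have /psumr_eq0P/(_ i isT) : \sum_i \sum_k A i k ^+ 2 = 0.
    apply: oppr_inj; rewrite oppr0 -[RHS]trA -sumrN; apply: eq_bigr => a _.
    rewrite mxE -sumrN; apply: eq_bigr => c _.
    by rewrite [A c a]ANE mulrN expr2.
  move=> H; have /psumr_eq0P/(_ k isT)/eqP : \sum_k A i k ^+ 2 = 0.
    by apply: H => a _; apply: sumr_ge0 => c _; exact: sqr_ge0.
  by rewrite sqrf_eq0 => H'; apply/eqP; apply: H' => c _; exact: sqr_ge0.
(* The (i, j) entry of [W, B] is (i - j) B_ij. *)
apply/is_diag_mxP => i j ij; have := A0 i j.
rewrite AE /W mul_diag_mx mul_mx_diag !mxE [B i j * _]mulrC -mulrBl => /eqP.
by rewrite mulf_eq0 subr_eq0 eqr_nat (negbTE ij) => /eqP.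
Qed.
End spectral.

(** * Contractions along cuts *)

Section transport.
Variables (R : realType) (m : nat) (P Q : 'M[R]_m).
Hypothesis QP : Q *m P = 1%:M.
Implicit Types (V W t : set 'M[R]_m) (br : 'M[R]_m -> 'M[R]_m -> 'M[R]_m).

Let PQ : P *m Q = 1%:M. Proof. exact: mulmx1C. Qed.

(** As Q is the inverse of P, this is the conjugate P V Q, written as a preimage so that membership
    unfolds directly. *)
Definition conj_pre V : set 'M[R]_m := [set X | V (Q *m X *m P)].
Definition conj_map (f : 'M[R]_m -> 'M[R]_m) X := P *m f (Q *m X *m P) *m Q.
Definition conj_br br X Y := P *m br (Q *m X *m P) (Q *m Y *m P) *m Q.

Let conjK X : Q *m (P *m X *m Q) *m P = X.
Proof. by rewrite !mulmxA QP mul1mx -mulmxA QP mulmx1. Qed.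

Let conjVK X : P *m (Q *m X *m P) *m Q = X.
Proof. by rewrite !mulmxA PQ mul1mx -mulmxA PQ mulmx1. Qed.

Let conjD (A B X Y : 'M[R]_m) : A *m (X + Y) *m B = A *m X *m B + A *m Y *m B.
Proof. by rewrite mulmxDr mulmxDl. Qed.

Let conjZ (A B : 'M[R]_m) (a : R) (X : 'M[R]_m) : A *m (a *: X) *m B = a *: (A *m X *m B).
Proof. by rewrite -scalemxAr -scalemxAl. Qed.

Lemma subspace_conj V : Defs.subspace V -> Defs.subspace (conj_pre V).
Proof.
move=> [V0 [VD VZ]]; split; first by rewrite /conj_pre/= mulmx0 mul0mx.
split=> [X Y VX VY|a X VX]; rewrite /conj_pre/=; first by rewrite conjD; exact: VD.
by rewrite conjZ; exact: VZ.
Qed.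

Lemma lie_subalg_conj V br t :
  lie_subalg V br t -> lie_subalg (conj_pre V) (conj_br br) (conj_pre t).
Proof.
move=> [st [tV tbr]]; split; first exact: subspace_conj.
split=> [X|X Y tX tY]; first exact: tV.
by rewrite /conj_pre/= conjK; exact: tbr.
Qed.

Lemma lie_contraction_conj V br t br' : lie_contraction V br t br' ->
  lie_contraction (conj_pre V) (conj_br br) (conj_pre t) (conj_br br').
Proof.
move=> [tc [pt [ptc [stc [tcV [ttc [dec lim]]]]]]].
exists (conj_pre tc), (conj_map pt), (conj_map ptc).
split; first exact: subspace_conj.
split; first by move=> X; exact: tcV.
split.
  by move=> X tX tcX; rewrite -[X]conjVK (ttc _ tX tcX) mulmx0 mul0mx.
split.
  move=> X /dec [tX tcX E]; rewrite /conj_pre/conj_map/=; rewrite !conjK; split=> //.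
  by rewrite -conjD -E conjVK.
move=> phi phiinv X Y VX VY.
have phiE e Z : phi e Z = P *m (pt (Q *m Z *m P) + e *: ptc (Q *m Z *m P)) *m Q.
  by rewrite conjD conjZ.
have phiinvE e Z : phiinv e Z = P *m (pt (Q *m Z *m P) + e^-1 *: ptc (Q *m Z *m P)) *m Q.
  by rewrite conjD conjZ.
rewrite /conj_br; under eq_fun do rewrite phiinvE !phiE !conjK.
apply: cvg_mulmx; last exact: cvg_cst.
apply: cvg_mulmx; first exact: cvg_cst.
exact: lim.
Qed.

Lemma lie_iso_comm_conjl V br W :
  lie_iso_comm V br W -> lie_iso_comm (conj_pre V) (conj_br br) W.
Proof.
move=> [f [flin [fVW [finj [fsurj fbr]]]]].
exists (fun X => f (Q *m X *m P)); split.
  by move=> a X Y; rewrite conjD conjZ flin.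
split; first by move=> X; exact: fVW.
split.
  by move=> X Y VX VY /(finj _ _ VX VY) E; rewrite -[X]conjVK E conjVK.
split.
  by move=> Z /fsurj [X [VX <-]]; exists (P *m X *m Q); rewrite /conj_pre/= conjK.
by move=> X Y VX VY; rewrite /conj_br conjK fbr.
Qed.

(** The bracket of the target stays the commutator, because conjugation is an automorphism of the
    matrix algebra. *)
Lemma lie_iso_comm_conjr V br W :
  lie_iso_comm V br W -> lie_iso_comm V br (conj_pre W).
Proof.
move=> [f [flin [fVW [finj [fsurj fbr]]]]].
exists (fun X => P *m f X *m Q); split.
  by move=> a X Y; rewrite flin conjD conjZ.
split; first by move=> X VX; rewrite /conj_pre/= conjK; exact: fVW.
split.
  move=> X Y VX VY E; apply: finj => //.
  by rewrite -[f X]conjK E conjK.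
split.
  by move=> Z /fsurj [X [VX E]]; exists X; rewrite E conjVK.
move=> X Y VX VY; rewrite fbr// /comm -!mulmxE mulmxBr mulmxBl !mulmxA.
by rewrite -(mulmxA _ Q P) QP mulmx1 -(mulmxA _ Q P) QP mulmx1.
Qed.

End transport.

(** * Commutators with restricted sums and contraction along one cut *)

Section contraction.
Variables (R : realType) (m : nat) (eps : 'I_m -> R).
Hypothesis eps1 : forall i, eps i * eps i = 1.
Implicit Types (X Y Z : 'M[R]_m) (chi : 'I_m -> 'I_m -> 'I_m -> bool) (s : 'I_m -> bool).

(** The Lie algebra of the orthogonal group of E = diag(eps): the equation X^T E + E X = 0 read
    entrywise. *)
Definition so_diag : set 'M[R]_m :=
  [set X | forall i j, eps i * X i j + eps j * X j i = 0].

Definition partial_comm chi X Y : 'M[R]_m :=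
  \matrix_(i, j) \sum_(k | chi i k j) (X i k * Y k j - Y i k * X k j).

Definition cut_chi chi s i k j := chi i k j && ((s k == s i) || (s k == s j)).

Definition cut_subalg s : set 'M[R]_m :=
  [set X | so_diag X /\ forall i j, s i != s j -> X i j = 0].

Lemma so_diagE X : so_diag X <-> forall i j, X i j = - (eps i * eps j * X j i).
Proof.
split=> H i j.
  have /(congr1 (fun x => eps i * x)) := H i j.
  by rewrite mulrDr mulrA eps1 mul1r mulr0 mulrA => /eqP; rewrite addr_eq0 => /eqP.
by rewrite H mulrN mulrA mulrA eps1 mul1r addNr.
Qed.

Lemma subspace_so_diag : Defs.subspace so_diag.
Proof.
split; first by move=> i j; rewrite !mxE !mulr0 addr0.
split=> [X Y VX VY i j|a X VX i j]; rewrite !mxE.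
  by rewrite !mulrDr addrACA VX VY addr0.
by rewrite !(mulrCA _ a) -mulrDr VX mulr0.
Qed.

(** The relation X_ij = - eps_i eps_j X_ji turns the term of k at (i, j) into - eps_i eps_j times
    its term at (j, i); by the symmetry of [chi] both sums run over the same k. *)
Lemma partial_comm_so chi X Y : (forall i k j, chi i k j = chi j k i) ->
  so_diag X -> so_diag Y -> so_diag (partial_comm chi X Y).
Proof.
move=> chiC /so_diagE VX /so_diagE VY; apply/so_diagE => i j; rewrite !mxE.
rewrite mulr_sumr -sumrN; apply: eq_big => [k|k _]; first by rewrite chiC.
rewrite [X i k]VX [Y k j]VY [Y i k]VY [X k j]VX.
rewrite !mulrN !mulNr !opprK.
have E x y : eps i * eps k * x * (eps k * eps j * y) = eps i * eps j * (y * x).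
  rewrite -[eps i * eps j]mulr1 -(eps1 k); ring.
by rewrite !E; ring.
Qed.

(** If the cut separates i from j, it separates k from one of them, so each product in the sum has a
    zero factor. *)
Lemma cut_lie_subalg chi s : (forall i k j, chi i k j = chi j k i) ->
  lie_subalg so_diag (partial_comm chi) (cut_subalg s).
Proof.
move=> chiC; have [V0 [VD VZ]] := subspace_so_diag.
split.
  split; first by split=> // i j _; rewrite mxE.
  split=> [X Y [VX sX] [VY sY]|a X [VX sX]].
    by split; [exact: VD|move=> i j ij; rewrite mxE sX// sY// addr0].
  by split; [exact: VZ|move=> i j ij; rewrite mxE sX// mulr0].
split=> [X []//|X Y [VX sX] [VY sY]]; split; first exact: partial_comm_so.
move=> i j ij; rewrite mxE big1// => k _.
have [ik|ik] := eqVneq (s i) (s k).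
  by rewrite [Y k j]sY ?[X k j]sX ?mulr0 ?subrr// -ik.
by rewrite [Y i k]sY ?[X i k]sX// !mul0r subrr.
Qed.

(** After rescaling, the term of k at (i, j) carries e to the power [s i != s k] + [s k != s j] -
    [s i != s j]. As s has two values, this exponent is 2 when k is separated from both i and j, and
    0 otherwise. *)
Lemma cut_contraction chi s : (forall i k j, chi i k j = chi j k i) ->
  lie_contraction so_diag (partial_comm chi) (cut_subalg s)
    (partial_comm (cut_chi chi s)).
Proof.
move=> chiC; have [V0 [VD VZ]] := subspace_so_diag.
(* The complement consists of the matrices whose diagonal blocks vanish. *)
exists [set X | so_diag X /\ forall i j, s i = s j -> X i j = 0].
pose pt X : 'M[R]_m := \matrix_(i, j) if s i == s j then X i j else 0.
pose ptc X : 'M[R]_m := \matrix_(i, j) if s i == s j then 0 else X i j.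
exists pt, ptc; split.
  split; first by split=> // i j _; rewrite mxE.
  split=> [X Y [VX sX] [VY sY]|a X [VX sX]].
    by split; [exact: VD|move=> i j ij; rewrite mxE sX// sY// addr0].
  by split; [exact: VZ|move=> i j ij; rewrite mxE sX// mulr0].
split; first by move=> X [].
split.
  move=> X [_ sX] [_ sX']; apply/matrixP => i j; rewrite mxE.
  by have [/sX'//|/sX] := eqVneq (s i) (s j).
split.
  move=> X VX; split.
  - split=> i j; rewrite !mxE; last by move/negbTE => ->.
    by rewrite (eq_sym (s j)); case: eqP => _; rewrite ?mulr0 ?addr0.
  - split=> i j; rewrite !mxE; last by move->; rewrite eqxx.
    by rewrite (eq_sym (s j)); case: eqP => _; rewrite ?mulr0 ?addr0.
  by apply/matrixP => i j; rewrite !mxE; case: eqP; rewrite ?addr0 ?add0r.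
move=> phi phiinv X Y _ _.
pose chi' i k j := chi i k j && ~~ ((s k == s i) || (s k == s j)).
have phiE e Z i j : (phi e Z) i j = (if s i == s j then 1 else e) * Z i j.
  by rewrite !mxE; case: eqP; rewrite ?mulr0 ?addr0 ?add0r ?mul1r.
(* chi' collects the terms with both factors in the complement and a result
   in the subalgebra. *)
have expand e : e != 0 -> phiinv e (partial_comm chi (phi e X) (phi e Y)) =
   partial_comm (cut_chi chi s) X Y + e ^+ 2 *: partial_comm chi' X Y.
  move=> e0; apply/matrixP => i j.
  have -> Z : (phiinv e Z) i j = (if s i == s j then 1 else e^-1) * Z i j.
    by rewrite !mxE; case: eqP; rewrite ?mulr0 ?addr0 ?add0r ?mul1r.
  rewrite !mxE (bigID (fun k => (s k == s i) || (s k == s j)))/= mulrDr.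
  rewrite !mulr_sumr; congr (_ + _); apply: eq_bigr => k /andP[_]; rewrite !phiE.
    by case: (s i); case: (s j); case: (s k) => //= _; field.
  by case: (s i); case: (s j); case: (s k) => //= _; ring.
apply: (@cvg_trans _ ((partial_comm (cut_chi chi s) X Y
     + e ^+ 2 *: partial_comm chi' X Y) @[e --> 0^'+])).
  apply: near_eq_cvg; near=> e; apply/esym/expand.
  by rewrite gt_eqF//; near: e; exact: nbhs_right_gt.
apply/cvg_mxP => i j; under eq_fun do rewrite mxE [X in _ + X]mxE.
set a := partial_comm (cut_chi chi s) X Y i j; set b := partial_comm chi' X Y i j.
have : a + e ^+ 2 * b @[e --> 0^'+] --> a + 0 ^+ 2 * b.
  apply: cvgD; first exact: cvg_cst.
  apply: cvgM; last exact: cvg_cst.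
  by apply: cvg_at_right_filter; exact: exprn_continuous.
by rewrite expr0n mul0r addr0.
Unshelve. all: by end_near. Qed.

(** * The chain of all cuts of a total preorder *)

Variable le : rel 'I_m.
Hypothesis tot_le : total le.
Hypothesis tr_le : transitive le.

(** The terms surviving the first l cuts, where cut l' splits off the indices [le]-below l'. Cuts
    come in the numerical order of the indices, whatever [le] is; equivalent indices give the same
    cut, and repeating a cut removes nothing more. *)
Definition cuts_chi (l : nat) i k j :=
  [forall l' : 'I_m, (l' < l)%N ==>
     ((le k l' == le i l') || (le k l' == le j l'))].

Lemma cuts_chiC l i k j : cuts_chi l i k j = cuts_chi l j k i.
Proof. by apply: eq_forallb => l'; rewrite orbC. Qed.

Lemma cuts_chiS (l : 'I_m) i k j :
  cuts_chi l.+1 i k j = cut_chi (cuts_chi l) (le^~ l) i k j.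
Proof.
apply/forallP/andP => [H|[/forallP H1 H2] l'].
  split; last by have := H l; rewrite ltnSn.
  by apply/forallP => l'; apply/implyP => ll; have := H l'; rewrite ltnW.
apply/implyP; rewrite ltnS leq_eqVlt => /orP[/eqP/val_inj -> //|ll].
by have := H1 l'; rewrite ll.
Qed.

Lemma cuts_chi0 i k j : cuts_chi 0 i k j.
Proof. by apply/forallP. Qed.

(** Let i be below j. The cut at j has both on its lower side and so forces k below j; the cut at k
    then forces i or j, hence i, below k. Conversely, if k lies between, every cut leaves k on the
    side of i or of j. *)
Lemma cuts_chi_between i k j :
  le i j && cuts_chi m i k j = le i k && le k j.
Proof.
have lexx x : le x x by have := tot_le x x; rewrite orbb.
apply/andP/andP => [[ij /forallP H]|[ik kj]].
  have := H k; have := H j; rewrite !ltn_ord !lexx ij => Hj Hk.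
  split; last by case: (le k j) Hj.
  have [jk|jk] := boolP (le j k); first exact: tr_le ij jk.
  by move: Hk; rewrite (negbTE jk); case: (le i k).
split; first exact: tr_le ik kj.
apply/forallP => l; rewrite ltn_ord/=.
have [kl|kl] := boolP (le k l); first by rewrite (tr_le ik kl).
have [jl|] := boolP (le j l); last by rewrite orbT.
by rewrite (tr_le kj jl) in kl.
Qed.

(** Block triangular matrices for the preorder, whose diagonal blocks, one per equivalence class,
    lie in the orthogonal algebras of the corresponding signs. *)
Definition limit_alg : set 'M[R]_m :=
  [set Z | (forall i j, ~~ le i j -> Z i j = 0) /\
   (forall i j, le i j -> le j i -> eps i * Z i j + eps j * Z j i = 0)].

(** By totality an element of [so_diag] is determined by its entries with i below j, and the
    relation of [so_diag] fills in the others. Truncation respects brackets because only the k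
    between i and j contribute. *)
Lemma limit_alg_iso : lie_iso_comm so_diag (partial_comm (cuts_chi m)) limit_alg.
Proof.
pose f X : 'M[R]_m := \matrix_(i, j) if le i j then X i j else 0.
exists f; split.
  by move=> a X Y; apply/matrixP => i j; rewrite !mxE; case: ifP; rewrite ?mulr0 ?addr0.
split.
  move=> X VX; split=> i j; rewrite !mxE; first by move/negbTE => ->.
  by move=> -> ->.
split.
  move=> X Y /so_diagE VX /so_diagE VY /matrixP XY; apply/matrixP => i j.
  have := XY i j; have := XY j i; rewrite !mxE.
  by case/orP: (tot_le i j) => -> //= H _; rewrite VX VY H.
split.
  move=> Z [Z0 Zs]; exists (\matrix_(i, j) if le i j then Z i j else - (eps i * eps j * Z j i)).
  have E : f (\matrix_(i, j) (if le i j then Z i j else - (eps i * eps j * Z j i))) = Z.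
    apply/matrixP => i j; rewrite !mxE; case: (boolP (le i j)) => // ij.
    by rewrite Z0.
  split=> //; apply/so_diagE => i j; rewrite !mxE.
  have ee x : x = eps i * eps j * (eps j * eps i * x).
    by rewrite mulrA -(mulrA (eps i)) (mulrA (eps j)) eps1 mul1r eps1 mul1r.
  case: ifPn => ij; case: ifPn => ji //.
  - have /(congr1 (fun x => eps i * x)) := Zs i j ij ji.
    by rewrite mulrDr mulrA eps1 mul1r mulr0 mulrA => /eqP; rewrite addr_eq0 => /eqP.
  - by rewrite mulrN opprK -ee.
  - by have := tot_le i j; rewrite (negbTE ij) (negbTE ji).
move=> X Y VX VY; apply/matrixP => i j; rewrite !mxE.
have -> : (if le i j then \sum_(k | cuts_chi m i k j) (X i k * Y k j - Y i k * X k j) else 0)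
   = \sum_(k | le i k && le k j) (X i k * Y k j - Y i k * X k j).
  case: ifP => ij.
    by apply: eq_bigl => k; rewrite -cuts_chi_between ij.
  by rewrite big1// => k; rewrite -cuts_chi_between ij.
rewrite big_mkcond/= -sumrB; apply: eq_bigr => k _; rewrite !mxE.
by case: (le i k); case: (le k j); rewrite /= ?(mul0r, mulr0, subrr).
Qed.

End contraction.

(** * Degenerating sequences of quadratic forms *)

Section normal_form.
Variables (R : realType) (m : nat).

(* [le i j] means e_i = O(e_j). *)
Record normal_form (S : nat -> 'M[R]_m) (eps : 'I_m -> R) (e : nat -> 'I_m -> R)
    (P Q : nat -> 'M[R]_m) (P0 Q0 : 'M[R]_m) (le : rel 'I_m) : Prop := NormalForm {
  nf_sign : forall i, eps i * eps i = 1;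
  nf_gt0 : forall n i, 0 < e n i;
  nf_inv : forall n, P n *m Q n = 1%:M;
  nf_cvgP : P @ \oo --> P0;
  nf_cvgQ : Q @ \oo --> Q0;
  nf_form : forall n, S n = (Q n)^T *m diag_mx (\row_i (eps i * e n i)) *m Q n;
  nf_total : total le;
  nf_trans : transitive le;
  nf_eq : forall i j, le i j -> le j i -> forall n, e n i = e n j;
  nf_small : forall i j, ~~ le i j -> e n j / e n i @[n --> \oo] --> 0 }.

(** After orthogonal diagonalization and extraction, eigenvalues of comparable size are replaced by
    one common size; the correction factors have positive limits and are absorbed into P and Q. *)
Lemma exists_normal_form (S : nat -> 'M[R]_m) :
  (forall n, (S n)^T = S n) -> (forall n, S n \in unitmx) ->
  exists sigma : nat -> nat, (forall n, (sigma n < sigma n.+1)%N) /\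
  exists eps e P Q P0 Q0 le, normal_form (S \o sigma) eps e P Q P0 Q0 le.
Proof.
move=> Ssym Sunit.
have /choice[K0 K0P] n := symmetric_diag (Ssym n).
pose d0 n i := ((K0 n)^T *m S n *m K0 n) i i.
have K0unit n : K0 n \in unitmx.
  by have [/mulmx1_unit[]] := K0P n.
have d0E n : (K0 n)^T *m S n *m K0 n = diag_mx (\row_i d0 n i).
  have [_ /is_diag_mxP dg] := K0P n.
  apply/matrixP => i j; rewrite [RHS]mxE [X in _ = X *+ _]mxE.
  by case: eqVneq => [->//|ij]; rewrite mulr0n dg.
have d0neq n i : d0 n i != 0.
  have : (K0 n)^T *m S n *m K0 n \in unitmx.
    by rewrite !unitmx_mul unitmx_tr K0unit Sunit.
  rewrite d0E unitmxE det_diag unitfE => /prodf_neq0/(_ i isT).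
  by rewrite mxE.
(* U0 is a bounded stand-in for the ratio e_i / e_j. *)
pose U0 n i j := `|d0 n i| / (`|d0 n i| + `|d0 n j|).
have d0gt n i : 0 < `|d0 n i| by rewrite normr_gt0.
have [|sigma1 [sinc1 [a cva]]] := @bolzano_weierstrass_fin R
    ('I_m * 'I_m + ('I_m * 'I_m + 'I_m))%type (fun n x => match x with
     | inl (i, j) => K0 n i j
     | inr (inl (i, j)) => U0 n i j
     | inr (inr i) => Num.sg (d0 n i) end) 1.
  move=> n [[i j]|[[i j]|i]].
  - by apply: orthogonal_entry_le; have [] := K0P n.
  - rewrite /U0 ger0_norm ?divr_ge0 ?addr_ge0//.
    by rewrite ler_pdivrMr ?addr_gt0// mul1r lerDl.
  - by rewrite normr_sg d0neq.
(* Convergent signs are eventually constant: two of them within 1/2 of the same limit cannot differ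
   by 2. *)
have [N NP] : exists N, forall n, (N <= n)%N -> forall i,
    Num.sg (d0 (sigma1 n) i) = Num.sg (d0 (sigma1 N) i).
  have : \forall n \near \oo, forall i, `|a (inr (inr i)) - Num.sg (d0 (sigma1 n) i)| < 2^-1.
    apply: filter_forall => i.
    have /cvgrPdist_lt/(_ _ (_ : 0 < 2^-1)) := cva (inr (inr i)).
    by apply; rewrite invr_gt0.
  move=> [N _ NP]; exists N => n Nn i.
  have /= := NP n Nn i; have /= := NP N (leqnn N) i.
  have sg1 k : Num.sg (d0 k i) = 1 \/ Num.sg (d0 k i) = -1.
    by case: sgrP (d0neq k i) => // _ _; [left|right].
  by case: (sg1 (sigma1 n)) => ->; case: (sg1 (sigma1 N)) => -> //;
    rewrite !ltr_norml => /andP[h1 h2] /andP[h3 h4]; lra.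
pose sigma n := sigma1 (n + N)%N.
have sinc n : (sigma n < sigma n.+1)%N by exact: sinc1.
exists sigma; split=> //.
have {}cva x := @cvg_subsequence _ _ _ (fun n => n + N)%N (fun n => ltnSn _) (cva x).
pose K n := K0 (sigma n); pose d n i := d0 (sigma n) i.
pose eps i := Num.sg (d0 (sigma1 N) i).
pose f n i := `|d n i|.
have dE n i : d n i = eps i * f n i.
  by rewrite /eps -(NP (n + N)%N (leq_addl _ _)) -numEsg.
have f0 n i : 0 < f n i by exact: d0gt.
pose U i j := a (inr (inl (i, j))).
have cvU i j : f n i / (f n i + f n j) @[n --> \oo] --> U i j := cva (inr (inl (i, j))).
pose Kl : 'M[R]_m := \matrix_(i, j) a (inl (i, j)).
have cvK : K @ \oo --> Kl.
  by apply/cvg_mxP => i j; rewrite mxE; exact: (cva (inl (i, j))).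
have U1 i j : U i j + U j i = 1.
  have : f n i / (f n i + f n j) + f n j / (f n j + f n i) @[n --> \oo]
      --> U i j + U j i by apply: cvgD; exact: cvU.
  rewrite (_ : (fun n => _) = cst 1).
    by move=> /cvg_lim <- //; rewrite lim_cst.
  apply/funext => n /=; have := f0 n i; have := f0 n j => h1 h2.
  by field; rewrite !gt_eqF// addr_gt0.
have Uge0 i j : 0 <= U i j.
  apply: (ler_cvg_to (cvg_cst 0) (cvU i j)); apply: nearW => n.
  by rewrite divr_ge0 ?addr_ge0 ?ltW.
(* The limiting share of f_i in f_i + f_j is below 1 exactly when f_i / f_j stays bounded. *)
pose le : rel 'I_m := [rel i j | U i j < 1].
have leE i j : le i j = (0 < U j i) by rewrite /le/= -(U1 i j) ltrDl.
have le_tot : total le.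
  by move=> i j; rewrite /le/=; have := U1 i j; have := Uge0 i j; case: ltrP; case: ltrP => //; lra.
have ratio n i j : f n i / f n j = (f n i / (f n i + f n j)) / (f n j / (f n j + f n i)).
  have := f0 n i; have := f0 n j => h1 h2; rewrite [f n j + _]addrC.
  field; rewrite ?gt_eqF// ?addr_gt0//.
have cvratio i j : le i j -> f n i / f n j @[n --> \oo] --> U i j / U j i.
  rewrite leE => Uji; under eq_fun do rewrite ratio.
  by apply: cvgM (cvU _ _) _; apply: cvgV (cvU _ _); rewrite gt_eqF.
have le_tr : transitive le.
  move=> j i k; rewrite !leE => Uji Ukj; rewrite lt_neqAle Uge0 andbT eq_sym.
  apply/eqP => Uki0.
  (* The product of the shares around a triangle does not depend on the orientation. If U k i
     vanished, one side would be 0 and the other positive. *)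
  have E : U i j * U j k * U k i = U i k * U k j * U j i.
    pose u n i j := f n i / (f n i + f n j).
    have c1 : u n i j * u n j k * u n k i @[n --> \oo] --> U i j * U j k * U k i.
      by apply: cvgM; [apply: cvgM|]; exact: cvU.
    have c2 : u n i k * u n k j * u n j i @[n --> \oo] --> U i k * U k j * U j i.
      by apply: cvgM; [apply: cvgM|]; exact: cvU.
    rewrite (_ : (fun n => _) = (fun n => u n i j * u n j k * u n k i)) in c2.
      exact: (cvg_unique _ c1 c2).
    apply/funext => n; rewrite /u.
    have := f0 n i; have := f0 n j; have := f0 n k => h1 h2 h3.
    by field; rewrite ?gt_eqF// ?addr_gt0.
  have Uik1 : U i k = 1 by rewrite -(U1 i k) Uki0 addr0.
  move: E; rewrite Uki0 mulr0 Uik1 mul1r => /esym/eqP.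
  by rewrite mulf_eq0 !gt_eqF.
pose cls i := [pred k | le i k && le k i].
have lexx i : le i i by have := le_tot i i; rewrite orbb.
(* Summing over the class makes e equal on equivalent indices for every n, not only
   asymptotically. *)
pose e n i := \sum_(k | cls i k) f n k.
have e0 n i : 0 < e n i.
  rewrite /e (bigD1 i)/= ?lexx// ltr_pwDl// sumr_ge0// => k _; exact: ltW.
pose r n i := e n i / f n i.
pose rl i := \sum_(k | cls i k) U k i / U i k.
have r0 n i : 0 < r n i by rewrite divr_gt0.
have cvr i : r n i @[n --> \oo] --> rl i.
  rewrite /r /e; under eq_fun do rewrite mulr_suml.
  apply: cvg_big; first exact: add_continuous.
  by move=> k /andP[_ ki]; exact: cvratio.
have rl0 i : 0 < rl i.
  rewrite /rl (bigD1 i)/= ?lexx// ltr_pwDl//.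
    by rewrite divr_gt0// -leE.
  by apply: sumr_ge0 => k _; rewrite divr_ge0.
(* Chosen so that e_i / w_i^2 = f_i: scaling by the inverses of the w_i takes the form eps_i e_i
   back to the eigenvalues d_i. *)
pose w n i := Num.sqrt (r n i).
have w0 n i : 0 < w n i by rewrite sqrtr_gt0.
have cvw i : w n i @[n --> \oo] --> Num.sqrt (rl i).
  by apply: (cvg_comp _ _ (cvr i)); exact: sqrt_continuous.
have KK n : (K n)^T *m K n = 1%:M by have [] := K0P (sigma n).
exists eps, e, (fun n => K n *m diag_mx (\row_i w n i)),
  (fun n => diag_mx (\row_i (w n i)^-1) *m (K n)^T),
  (Kl *m diag_mx (\row_i Num.sqrt (rl i))),
  (diag_mx (\row_i (Num.sqrt (rl i))^-1) *m Kl^T), le.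
have wwV n : diag_mx (\row_i w n i) *m diag_mx (\row_i (w n i)^-1) = 1%:M.
  rewrite mulmx_diag -diag_const_mx; congr diag_mx; apply/rowP => i.
  by rewrite !mxE divff// gt_eqF.
have cvdiag (g : nat -> 'I_m -> R) (g0 : 'I_m -> R) :
    (forall i, g n i @[n --> \oo] --> g0 i) ->
    diag_mx (\row_i g n i) @[n --> \oo] --> diag_mx (\row_i g0 i).
  move=> gg; apply/cvg_mxP => i j; rewrite !mxE.
  under eq_fun do rewrite !mxE.
  by case: eqP => _; [exact: gg|exact: cvg_cst].
split=> //.
- move=> i; rewrite -expr2 sqr_sg d0neq//.
- move=> n; rewrite mulmxA -(mulmxA (K n)) wwV mulmx1; exact: mulmx1C.
- by apply: cvg_mulmx => //; exact: cvdiag.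
- apply: cvg_mulmx; last exact: cvg_trmx.
  by apply: cvdiag => i; apply: cvgV; [rewrite gt_eqF// sqrtr_gt0|exact: cvw].
- move=> n; rewrite trmx_mul trmxK tr_diag_mx.
  have -> : K n *m diag_mx (\row_i (w n i)^-1) *m diag_mx (\row_i (eps i * e n i)) *m
      (diag_mx (\row_i (w n i)^-1) *m (K n)^T) =
      K n *m (diag_mx (\row_i (w n i)^-1) *m diag_mx (\row_i (eps i * e n i)) *m
      diag_mx (\row_i (w n i)^-1)) *m (K n)^T by rewrite !mulmxA.
  have -> : diag_mx (\row_i (w n i)^-1) *m diag_mx (\row_i (eps i * e n i)) *m
      diag_mx (\row_i (w n i)^-1) = diag_mx (\row_i d n i).
    rewrite !mulmx_diag; congr diag_mx; apply/rowP => i; rewrite !mxE dE.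
    have ww : w n i * w n i = e n i / f n i by rewrite -expr2 sqr_sqrtr// ltW.
    rewrite mulrC mulrA -invfM ww; have := f0 n i; have := e0 n i => h1 h2.
    by field; rewrite !gt_eqF.
  rewrite -d0E -/(K n) !mulmxA (mulmx1C (KK n)) mul1mx -mulmxA.
  by rewrite (mulmx1C (KK n)) mulmx1.
- move=> i j ij ji n; apply: eq_bigl => k /=; apply/andP/andP => -[h1 h2]; split.
  + exact: le_tr ji h1.
  + exact: le_tr h2 ij.
  + exact: le_tr ij h1.
  + exact: le_tr h2 ji.
- move=> i j; rewrite leE => Uji.
  have Uji0 : U j i = 0 by apply/eqP; rewrite eq_le Uge0 leNgt Uji.
  have ji : le j i by rewrite /le/= Uji0.
  have rE n : e n j / e n i = f n j / f n i * (r n j / r n i).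
    rewrite /r; have := f0 n i; have := e0 n i; have := f0 n j => h1 h2 h3.
    by field; rewrite !gt_eqF.
  under eq_fun do rewrite rE.
  rewrite -(mul0r (rl j / rl i)) -(mul0r (U i j)^-1) -Uji0.
  apply: cvgM; first exact: cvratio.
  by apply: cvgM (cvr j) _; apply: cvgV (cvr i); rewrite gt_eqF.
Qed.
End normal_form.

(** * The Lie algebra of a geometric limit *)

Section similitude.
Variables (R : realType) (m : nat).
Implicit Types (A B X Z S : 'M[R]_m) (d : 'I_m -> R) (kappa : R).

(** With D = diag(d), multiplying by adj(B)^T gives det(B) D B = kappa adj(B)^T D. Its (k, k) entry
    eliminates kappa and det(B) from its (i, j) entry. *)
Lemma similitude_adj d B kappa : (forall i, d i != 0) -> kappa != 0 ->
  B^T *m diag_mx (\row_i d i) *m B = kappa *: diag_mx (\row_i d i) ->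
  forall i j k, d i * B i j * (\adj B) k k = d j * (\adj B) j i * B k k.
Proof.
move=> d0 k0 BDB.
have Dunit : diag_mx (\row_i d i) \in unitmx.
  by rewrite unitmxE det_diag unitfE; apply/prodf_neq0 => i _; rewrite mxE.
have : B \in unitmx.
  have : B^T *m diag_mx (\row_i d i) *m B \in unitmx.
    by rewrite BDB unitmxZ// unitfE.
  by rewrite !unitmx_mul => /andP[].
rewrite unitmxE unitfE => detB.
have E i j : \det B * (d i * B i j) = kappa * (\adj B j i * d j).
  have /matrixP/(_ i j) : \det B *: (diag_mx (\row_i d i) *m B) =
      kappa *: ((\adj B)^T *m diag_mx (\row_i d i)).
    rewrite [RHS]scalemxAr -BDB !mulmxA -trmx_mul mul_mx_adj tr_scalar_mx.
    by rewrite -mulmxA mul_scalar_mx.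
  by rewrite mul_diag_mx mul_mx_diag !mxE.
move=> i j k.
have Ek : kappa * \adj B k k = \det B * B k k.
  by apply: (mulIf (d0 k)); rewrite -mulrA -E; ring.
apply: (mulfI (mulf_neq0 detB k0)).
have -> : \det B * kappa * (d i * B i j * \adj B k k) =
   (\det B * (d i * B i j)) * (kappa * \adj B k k) by ring.
by rewrite E Ek; ring.
Qed.

(** Dividing by d_i leaves only the ratio d_j / d_i, and the adjugate is continuous. At E it becomes
    the inverse, since each side contains it once. *)
Lemma similitude_limit (d : nat -> 'I_m -> R) (B : nat -> 'M[R]_m) (kappa : nat -> R)
    (E : 'M[R]_m) i j (rho : R) :
  (forall n i, d n i != 0) -> (forall n, kappa n != 0) ->
  (forall n, (B n)^T *m diag_mx (\row_i d n i) *m B n = kappa n *: diag_mx (\row_i d n i)) ->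
  B @ \oo --> E -> E \in unitmx -> d n j / d n i @[n --> \oo] --> rho ->
  forall k, E i j * invmx E k k = rho * (invmx E j i * E k k).
Proof.
move=> d0 k0 BDB BE Eunit drho k.
have detE : \det E != 0 by move: Eunit; rewrite unitmxE unitfE.
have cvB := iffLR (cvg_mxP _ _) BE.
have cvadj := iffLR (cvg_mxP _ _) (cvg_adj BE).
have c1 : B n i j * (\adj (B n)) k k @[n --> \oo] --> E i j * (\adj E) k k.
  by apply: cvgM; [exact: cvB|exact: cvadj].
have c2 : d n j / d n i * ((\adj (B n)) j i * B n k k) @[n --> \oo] -->
    rho * ((\adj E) j i * E k k).
  by apply: cvgM => //; apply: cvgM; [exact: cvadj|exact: cvB].
have E12 : E i j * (\adj E) k k = rho * ((\adj E) j i * E k k).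
  rewrite (_ : (fun n => _) = (fun n => B n i j * (\adj (B n)) k k)) in c2.
    exact: (cvg_unique _ c1 c2).
  apply/funext => n; apply: (mulfI (d0 n i)).
  rewrite [RHS]mulrA (similitude_adj (d0 n) (k0 n) (BDB n)).
  by field.
have invE a b : invmx E a b = (\det E)^-1 * \adj E a b by rewrite /invmx Eunit mxE.
by rewrite !invE mulrCA E12; ring.
Qed.

(** Differentiation gives X_ii - X_kk = X_kk - X_ii, so the diagonal is constant, and the trace
    kills it. *)
Lemma expm_trace0_diag X : \tr X = 0 ->
  (forall (t : R) i k, expm (t *: X) i i * expm ((- t) *: X) k k =
     1 * (expm ((- t) *: X) i i * expm (t *: X) k k)) ->
  forall i, X i i = 0.
Proof.
move=> trX H i.
have Xk k : X k k = X i i.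
  have := @expm_rel_derive _ _ X 1 i i k (fun t => H t i k).
  by rewrite eqxx !mul1r => E; lra.
have : X i i *+ m = 0.
  by rewrite -[RHS]trX /mxtrace (eq_bigr (fun=> X i i))// sumr_const card_ord.
move=> /eqP; rewrite mulrn_eq0 => /orP[/eqP m0|/eqP//].
by have := ltn_ord i; rewrite {2}m0.
Qed.

(** The case i = j, with ratio 1, kills the diagonal of X; the differentiated relation at k = i then
    reduces to its off-diagonal part. *)
Lemma expm_similitude_limit (d : nat -> 'I_m -> R) X :
  (forall n i, d n i != 0) -> \tr X = 0 ->
  (forall t : R, exists (B : nat -> 'M[R]_m) (kappa : nat -> R),
     [/\ forall n, kappa n != 0,
      forall n, (B n)^T *m diag_mx (\row_i d n i) *m B n = kappa n *: diag_mx (\row_i d n i)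
      & B @ \oo --> expm (t *: X)]) ->
  forall i j (rho : R), d n j / d n i @[n --> \oo] --> rho -> X i j = - (rho * X j i).
Proof.
move=> d0 trX HB.
have rel t i j (rho : R) : d n j / d n i @[n --> \oo] --> rho -> forall k,
    expm (t *: X) i j * expm ((- t) *: X) k k =
    rho * (expm ((- t) *: X) j i * expm (t *: X) k k).
  move=> drho k; have [B [kappa [k0 BDB BE]]] := HB t.
  have [uE <-] := invmx_expm X t.
  exact: (similitude_limit d0 k0 BDB BE uE drho).
have X0 : forall i, X i i = 0.
  apply: expm_trace0_diag => // t i k; apply: rel.
  by rewrite (_ : (fun n => _) = cst 1); [exact: cvg_cst|apply/funext => n; rewrite divff].
move=> i j rho drho.
have := @expm_rel_derive _ _ X rho i j i (fun t => rel t i j rho drho i).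
by rewrite X0 !mulr0 subr0 sub0r mulrN.
Qed.

Lemma expm_so d X (t : R) : (forall i j, d i * X i j + d j * X j i = 0) ->
  (expm (t *: X))^T *m diag_mx (\row_i d i) *m expm (t *: X) = diag_mx (\row_i d i).
Proof.
move=> H; rewrite -expm_tr (_ : (t *: X)^T = t *: X^T); last first.
  by apply/matrixP => i j; rewrite !mxE.
apply: expm_intertwine; apply/matrixP => i j; rewrite -mulmxE.
by rewrite mxE mul_diag_mx mul_mx_diag !mxE addrC [X j i * _]mulrC H.
Qed.

End similitude.

(** * Lie algebra of the limit in coordinates adapted to the forms *)

Section geometric_limit.
Variables (R : realType) (m : nat).
Implicit Types (A B X Z S : 'M[R]_m).

(** A sequence chosen along [sigma] is completed by arbitrary elements of H n off the range of
    [sigma]; its accumulation points are then accumulation points for the whole sequence of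
    groups. *)
Lemma geom_cvg_subsequence (H : nat -> set 'M[R]_m) (L : set 'M[R]_m) (sigma : nat -> nat) :
  (forall n, (sigma n < sigma n.+1)%N) -> (forall n, exists A, H n A) ->
  geom_cvg H L -> geom_cvg (H \o sigma) L.
Proof.
move=> sinc H0 [HL1 HL2]; split.
  move=> A /HL1 [h [Hh [uA [c [c0 cA]]]]]; exists (h \o sigma); split.
    by move=> n; exact: Hh.
  split=> //; exists (c \o sigma); split; first by move=> n; exact: c0.
  exact: (cvg_subsequence sinc cA).
move=> h Hh A [tau [tinc hA]].
have smono := homo_ltn ltn_trans sinc.
have /choice[h' h'P] : forall n, exists B, H n B /\ forall k, sigma k = n -> B = h k.
  move=> n; have [[k kn]|no] := pselect (exists k, sigma k = n).
    exists (h k); split; first by rewrite -kn; exact: Hh.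
    by move=> l ln; congr h; case: (ltngtP k l) => // /smono; rewrite kn ln ltnn.
  by have [B HB] := H0 n; exists B; split=> // k kn; case: no; exists k.
apply: (HL2 h' (fun n => (h'P n).1)); exists (sigma \o tau); split.
  by move=> n /=; exact: (smono _ _ (tinc n)).
rewrite (_ : h' \o (sigma \o tau) = h \o tau)//.
by apply/funext => n /=; exact: (h'P _).2.
Qed.

Variables (S : nat -> 'M[R]_m) (eps : 'I_m -> R) (e : nat -> 'I_m -> R)
  (P Q : nat -> 'M[R]_m) (P0 Q0 : 'M[R]_m) (le : rel 'I_m).
Hypothesis nf : normal_form S eps e P Q P0 Q0 le.

Let D n := diag_mx (\row_i (eps i * e n i)).

Let eps0 i : eps i != 0.
Proof.
by apply/eqP => E; have := nf_sign nf i; rewrite E mul0r => /esym/eqP; rewrite oner_eq0.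
Qed.

Let d0 n i : eps i * e n i != 0.
Proof. by rewrite mulf_neq0// gt_eqF// (nf_gt0 nf). Qed.

Lemma normal_form_inv : Q0 *m P0 = 1%:M.
Proof.
apply: mulmx1C; apply: (cvg_unique _ (cvg_mulmx (nf_cvgP nf) (nf_cvgQ nf))) => //.
rewrite (_ : (fun n => _) = cst 1%:M); first exact: cvg_cst.
by apply/funext => n; exact: (nf_inv nf).
Qed.

Let QP n : Q n *m P n = 1%:M. Proof. exact: mulmx1C (nf_inv nf n). Qed.

Let PSP n : (P n)^T *m S n *m P n = D n.
Proof.
rewrite (nf_form nf) !mulmxA -trmx_mul QP trmx1 mul1mx -mulmxA QP mulmx1//.
Qed.

Let ratio n i j : eps j * e n j / (eps i * e n i) = eps i * eps j * (e n j / e n i).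
Proof.
have h := nf_gt0 nf n i; apply: (mulIf (d0 n i)); rewrite mulfVK//.
transitivity (eps i * eps i * (eps j * e n j)); first by rewrite (nf_sign nf) mul1r.
by field; rewrite gt_eqF.
Qed.

(** Conjugating approximants of exp(tX) by Q n and P n gives similitudes of the diagonal forms
    converging to exp(tZ). The ratio limits are 0 when i is not below j and eps_i eps_j when i and j
    are equivalent. *)
Lemma lie_alg_limit_sub (H : nat -> set 'M[R]_m) (L : set 'M[R]_m) :
  (forall n A, H n A -> exists2 kappa : R, kappa != 0 & A^T *m S n *m A = kappa *: S n) ->
  geom_cvg H L -> forall X, lie_alg L X -> limit_alg eps le (Q0 *m X *m P0).
Proof.
move=> HS [HL _] X [trX LX]; set Z := Q0 *m X *m P0.
have trZ : \tr Z = 0.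
  by rewrite /Z -mulmxA mxtrace_mulC -mulmxA (mulmx1C normal_form_inv) mulmx1.
have key := @expm_similitude_limit _ _ (fun n i => eps i * e n i) Z d0 trZ.
have {}key : forall i j (rho : R), eps j * e n j / (eps i * e n i) @[n --> \oo] --> rho ->
    Z i j = - (rho * Z j i).
  apply: key => t.
  have [h [Hh [_ [c [c0 cA]]]]] := HL _ (LX t).
  have /choice[k kP] : forall n, exists k : R, k != 0 /\ (h n)^T *m S n *m h n = k *: S n.
    by move=> n; have [k k0 kE] := HS n _ (Hh n); exists k.
  exists (fun n => Q n *m (c n *: h n) *m P n), (fun n => c n * c n * k n); split.
  - by move=> n; rewrite !mulf_neq0//; exact: (kP n).1.
  - move=> n; rewrite -/(D n) -PSP !trmx_mul.
    have -> : (P n)^T *m ((c n *: h n)^T *m (Q n)^T) *m ((P n)^T *m S n *m P n) *m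
        (Q n *m (c n *: h n) *m P n) =
        (P n)^T *m ((c n *: h n)^T *m ((P n *m Q n)^T *m S n *m (P n *m Q n))
          *m (c n *: h n)) *m P n.
      by rewrite !trmx_mul !mulmxA.
    have -> : (c n *: h n)^T *m ((P n *m Q n)^T *m S n *m (P n *m Q n)) *m (c n *: h n)
        = (c n * c n * k n) *: S n.
      rewrite (nf_inv nf) trmx1 mul1mx mulmx1 linearZ/= [(_ *: _)^T]linearZ/=
        -!scalemxAl.
      by rewrite (kP n).2 !scalerA.
    by rewrite -scalemxAr -scalemxAl.
  - have -> : expm (t *: Z) = Q0 *m expm (t *: X) *m P0.
      rewrite -expm_conj; last exact: normal_form_inv.
      by rewrite -scalemxAr -scalemxAl.
    by apply: cvg_mulmx (nf_cvgP nf); apply: cvg_mulmx (nf_cvgQ nf) cA.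
split=> i j ij.
  have := key i j 0; rewrite mul0r oppr0; apply.
  under eq_fun do rewrite ratio.
  rewrite -[X in nbhs X](mulr0 (eps i * eps j)).
  by apply: cvgM; [exact: cvg_cst|exact: (nf_small nf)].
move=> ji; rewrite (key i j (eps i * eps j)).
  by rewrite mulrN !mulrA (nf_sign nf) mul1r addNr.
under eq_fun do rewrite ratio.
rewrite (_ : (fun n => _) = cst (eps i * eps j)); first exact: cvg_cst.
apply/funext => n; rewrite (nf_eq nf ij ji) divff ?mulr1// gt_eqF//.
exact: (nf_gt0 nf).
Qed.

(** Z is perturbed to Y n in the Lie algebra of the n-th diagonal form; the exponentials are
    isometries, and conjugated back they converge to exp(tX). *)
Lemma lie_alg_limit_sup (H : nat -> set 'M[R]_m) (L : set 'M[R]_m) :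
  (forall n A, A^T *m S n *m A = S n -> H n A) ->
  geom_cvg H L -> forall X, limit_alg eps le (Q0 *m X *m P0) -> lie_alg L X.
Proof.
move=> HS [_ HL] X; set Z := Q0 *m X *m P0 => -[Z0 Zs].
have XE : X = P0 *m Z *m Q0.
  have PQ0 := mulmx1C normal_form_inv.
  by rewrite /Z !mulmxA PQ0 mul1mx -mulmxA PQ0 mulmx1.
clearbody Z.
have Zii i : Z i i = 0.
  have ii : le i i by have := nf_total nf i i; rewrite orbb.
  have /eqP := Zs i i ii ii.
  by rewrite -mulr2n mulrn_eq0/= mulf_eq0 (negbTE (eps0 i)) => /eqP.
split.
  rewrite XE -mulmxA mxtrace_mulC -mulmxA normal_form_inv mulmx1.
  by rewrite /mxtrace big1// => i _; exact: Zii.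
move=> t.
(* The entries with i not below j are forced by the n-th form; they tend to 0, the value of Z
   there. *)
pose Y n : 'M[R]_m := \matrix_(i, j) if le i j then Z i j
  else - (eps i * eps j * (e n j / e n i) * Z j i).
have YZ : Y @ \oo --> Z.
  apply/cvg_mxP => i j; under eq_fun do rewrite mxE.
  case: (boolP (le i j)) => ij; first exact: cvg_cst.
  rewrite Z0// -oppr0 -(mul0r (Z j i)) -(mulr0 (eps i * eps j)).
  apply: cvgN; apply: cvgM; last exact: cvg_cst.
  by apply: cvgM; [exact: cvg_cst|exact: (nf_small nf)].
have Yso n i j : eps i * e n i * Y n i j + eps j * e n j * Y n j i = 0.
  have half k l : ~~ le k l -> eps k * e n k * Y n k l + eps l * e n l * Y n l k = 0.
    move=> kl; have lk : le l k by have := nf_total nf k l; rewrite (negbTE kl).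
    rewrite !mxE (negbTE kl) lk -ratio; have := d0 n k => h.
    by rewrite mulrN [_ * Z l k]mulrC mulrCA [_ * (_ / _)]mulrC mulfVK// mulrC addNr.
  have [ij|/half//] := boolP (le i j); have [ji|/half] := boolP (le j i); last by rewrite addrC.
  rewrite !mxE ij ji (nf_eq nf ij ji n) -!mulrA ![e n j * _]mulrC !mulrA -mulrDl.
  by rewrite Zs// mul0r.
apply: (HL (fun n => P n *m expm (t *: Y n) *m Q n)).
  move=> n; apply: HS; rewrite !trmx_mul [in LHS](nf_form nf).
  have -> : (Q n)^T *m ((expm (t *: Y n))^T *m (P n)^T) *m
     ((Q n)^T *m diag_mx (\row_i (eps i * e n i)) *m Q n) *m
     (P n *m expm (t *: Y n) *m Q n) = 
     (Q n)^T *m ((expm (t *: Y n))^T *m ((Q n *m P n)^T *m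
       diag_mx (\row_i (eps i * e n i)) *m (Q n *m P n)) *m expm (t *: Y n)) *m Q n.
    by rewrite !trmx_mul !mulmxA.
  rewrite QP trmx1 mul1mx mulmx1 (@expm_so _ _ (fun i => eps i * e n i))//.
  by rewrite -(nf_form nf).
exists id; split=> //; split; first by have [] := invmx_expm X t.
exists (fun=> 1); split; first by move=> _; exact: oner_neq0.
under eq_fun do rewrite /= scale1r.
have -> : t *: X = P0 *m (t *: Z) *m Q0 by rewrite XE -scalemxAr -scalemxAl.
rewrite expm_conj; last exact: mulmx1C normal_form_inv.
apply: cvg_mulmx (nf_cvgQ nf); apply: cvg_mulmx (nf_cvgP nf) _.
apply: cvg_expm_seq; apply/cvg_mxP => i j; rewrite mxE.
under eq_fun do rewrite mxE.
by apply: cvgM; [exact: cvg_cst|exact: (iffLR (cvg_mxP _ _) YZ)].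
Qed.

End geometric_limit.

(** * PO(p,q), its conjugates and its Lie algebra *)

Section indefinite_orthogonal.
Variables (R : realType) (m p : nat).
Implicit Types (A B X : 'M[R]_m).

Let J : 'M[R]_m := Jpq R m p.
Let jd (i : 'I_m) : R := if (i < p)%N then -1 else 1.

Lemma Jpq_diag : J = diag_mx (\row_i jd i).
Proof. by apply/matrixP => i j; rewrite !mxE; case: eqP. Qed.

Let jd0 i : jd i != 0.
Proof. by rewrite /jd; case: ifP; rewrite ?oppr_eq0 oner_eq0. Qed.

Lemma Jpq_unit : J \in unitmx.
Proof.
by rewrite Jpq_diag unitmxE det_diag unitfE; apply/prodf_neq0 => i _; rewrite mxE.
Qed.

Lemma POpq_similitude A : POpq p A ->
  exists2 kappa : R, kappa != 0 & A^T *m J *m A = kappa *: J.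
Proof.
move=> [c [c0 cA]]; exists (c ^- 2); first by rewrite invr_eq0 expf_neq0.
have : (c *: A)^T *m J *m (c *: A) = J by [].
have -> : (c *: A)^T = c *: A^T by apply/matrixP => i j; rewrite !mxE.
rewrite -!scalemxAl -scalemxAr scalerA -expr2 => {2}<-.
by rewrite scalerA mulVf ?scale1r// expf_neq0.
Qed.

(** Membership in the saturated group only makes exp(tX) a similitude; [expm_similitude_limit] with
    constant sequences uses the zero trace to remove the scalar part. *)
Lemma lie_alg_POpq X : lie_alg (@POpq R m p) X <-> X^T *m J + J *m X = 0.
Proof.
have entry : X^T *m J + J *m X = 0 <-> forall i j, jd i * X i j + jd j * X j i = 0.
  rewrite Jpq_diag; split=> [/matrixP H i j|H].
    by have := H i j; rewrite mxE mul_mx_diag mul_diag_mx !mxE addrC [X j i * _]mulrC.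
  apply/matrixP => i j.
  by rewrite mxE mul_mx_diag mul_diag_mx !mxE addrC [X j i * _]mulrC H.
rewrite entry; split=> [[trX HX] i j|H].
  rewrite (@expm_similitude_limit _ _ (fun=> jd) X _ trX _ i j (jd j / jd i))//.
  - by rewrite mulrN mulrA mulrCA divff// mulr1 addNr.
  - move=> t; have [k k0 kE] := POpq_similitude (HX t).
    exists (fun=> expm (t *: X)), (fun=> k); split=> //; last exact: cvg_cst.
    by move=> _; rewrite -Jpq_diag.
  - exact: cvg_cst.
split.
  rewrite /mxtrace big1// => i _; have /eqP := H i i.
  by rewrite -mulr2n mulrn_eq0/= mulf_eq0 (negbTE (jd0 i)) => /eqP.
move=> t; exists 1; split; first exact: oner_neq0.
rewrite /Opq/= scale1r -/J Jpq_diag; exact: expm_so.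
Qed.

Variable b : 'M[R]_m.
Hypothesis bU : b \in unitmx.
Let S := (invmx b)^T *m J *m invmx b.

Lemma pullback_sym : S^T = S.
Proof. by rewrite /S !trmx_mul trmxK Jpq_diag tr_diag_mx mulmxA. Qed.

Lemma pullback_unit : S \in unitmx.
Proof. by rewrite !unitmx_mul unitmx_tr unitmx_inv bU Jpq_unit. Qed.

Lemma conj_POpq_similitude A : conjset b (@POpq R m p) A ->
  exists2 kappa : R, kappa != 0 & A^T *m S *m A = kappa *: S.
Proof.
move=> [B /POpq_similitude [k k0 kE] <-]; exists k => //.
rewrite /S !trmx_mul.
have -> : (invmx b)^T *m (B^T *m b^T) *m ((invmx b)^T *m J *m invmx b) *m (b *m B *m invmx b)
  = (invmx b)^T *m (B^T *m ((invmx b *m b)^T *m J *m (invmx b *m b)) *m B) *m invmx b.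
  by rewrite !trmx_mul !mulmxA.
by rewrite mulVmx// trmx1 mul1mx mulmx1 kE -scalemxAr -scalemxAl.
Qed.

Lemma conj_POpq_isometry A : A^T *m S *m A = S -> conjset b (@POpq R m p) A.
Proof.
move=> AS; exists (invmx b *m A *m b); last first.
  by rewrite !mulmxA mulmxV// mul1mx -mulmxA mulmxV// mulmx1.
exists 1; split; first exact: oner_neq0.
rewrite /Opq/= scale1r -/J !trmx_mul.
have -> : b^T *m (A^T *m (invmx b)^T) *m J *m (invmx b *m A *m b) =
   b^T *m (A^T *m S *m A) *m b by rewrite /S !mulmxA.
rewrite AS /S !mulmxA -trmx_mul mulVmx// trmx1 mul1mx.
by rewrite -mulmxA mulVmx// mulmx1.
Qed.

Lemma conj_POpq_1 : conjset b (@POpq R m p) 1%:M.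
Proof. by apply: conj_POpq_isometry; rewrite trmx1 mul1mx mulmx1. Qed.

(** With G = diag(sqrt e) Q b one has J = G^T diag(eps) G, so conjugation by G carries po(p,q) to
    [so_diag eps]; the signs need not be counted. *)
Lemma so_diag_congruent (eps e : 'I_m -> R) (P Q : 'M[R]_m) :
  (forall i, 0 < e i) -> P *m Q = 1%:M ->
  S = Q^T *m diag_mx (\row_i (eps i * e i)) *m Q ->
  exists F G : 'M[R]_m, G *m F = 1%:M /\
    lie_alg (@POpq R m p) = conj_pre F G (so_diag eps).
Proof.
move=> e0 PQ SE; pose w i := Num.sqrt (e i).
have w0 i : w i != 0 by rewrite gt_eqF// sqrtr_gt0.
pose F := invmx b *m P *m diag_mx (\row_i (w i)^-1).
pose G := diag_mx (\row_i w i) *m Q *m b.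
have wwV : diag_mx (\row_i w i) *m diag_mx (\row_i (w i)^-1) = 1%:M.
  rewrite mulmx_diag -diag_const_mx; congr diag_mx; apply/rowP => i.
  by rewrite !mxE divff.
have GF : G *m F = 1%:M.
  rewrite /G /F !mulmxA -(mulmxA _ b) mulmxV// mulmx1 -(mulmxA _ Q) (mulmx1C PQ).
  by rewrite mulmx1.
have FG := mulmx1C GF.
pose E := diag_mx (\row_i eps i).
have JE : J = G^T *m E *m G.
  have -> : J = b^T *m S *m b.
    rewrite /S !mulmxA -trmx_mul mulVmx// trmx1 mul1mx.
    by rewrite -mulmxA mulVmx// mulmx1.
  rewrite SE /G !trmx_mul tr_diag_mx !mulmxA.
  have -> : diag_mx (\row_i (eps i * e i)) =
     diag_mx (\row_i w i) *m E *m diag_mx (\row_i w i).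
    rewrite !mulmx_diag; congr diag_mx; apply/rowP => i; rewrite !mxE.
    by rewrite mulrAC -expr2 sqr_sqrtr ?ltW// mulrC.
  by rewrite !mulmxA.
clearbody F G; exists F, G; split=> //; apply/seteqP; split=> X.
  move=> /lie_alg_POpq; rewrite JE => H.
  have {}H : (G *m X *m F)^T *m E + E *m (G *m X *m F) = 0.
    transitivity (F^T *m (X^T *m (G^T *m E *m G) + G^T *m E *m G *m X) *m F).
      rewrite mulmxDr mulmxDl !trmx_mul !mulmxA; congr (_ + _).
        by rewrite -(mulmxA _ G F) GF mulmx1.
      by rewrite -trmx_mul GF trmx1 mul1mx.
    by rewrite H mulmx0 mul0mx.
  move=> i j; have /matrixP/(_ i j) := H.
  move: (G *m X *m F) => Y.
  by rewrite mxE mul_mx_diag mul_diag_mx !mxE addrC [Y j i * _]mulrC.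
move=> H; apply/lie_alg_POpq; rewrite JE.
have {}H : (G *m X *m F)^T *m E + E *m (G *m X *m F) = 0.
  apply/matrixP => i j; have := H i j; move: (G *m X *m F) => Y.
  by rewrite mxE mul_mx_diag mul_diag_mx !mxE addrC [Y j i * _]mulrC.
transitivity (G^T *m ((G *m X *m F)^T *m E + E *m (G *m X *m F)) *m G).
  rewrite mulmxDr mulmxDl !trmx_mul !mulmxA; congr (_ + _).
    by rewrite -[G^T *m F^T]trmx_mul FG trmx1 mul1mx.
  by rewrite -(mulmxA _ F G) FG mulmx1.
by rewrite H mulmx0 mul0mx.
Qed.

End indefinite_orthogonal.

Theorem theorem2p6 (R : realType) (p q : nat) (b : nat -> 'M[R]_(p + q))
    (O' : set 'M[R]_(p + q)) :
  (forall n, b n \in unitmx) ->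
  pgl_set O' ->
  geom_cvg (fun n => conjset (b n) (@POpq R (p + q) p)) O' ->
  exists (s : nat) (br : nat -> 'M[R]_(p + q) -> 'M[R]_(p + q) -> 'M[R]_(p + q))
         (t : nat -> set 'M[R]_(p + q)),
    let h0 := lie_alg (@POpq R (p + q) p) in
    (forall X Y, h0 X -> h0 Y -> br 0%N X Y = comm X Y) /\
    (forall l, (l < s)%N ->
       lie_subalg h0 (br l) (t l) /\ lie_contraction h0 (br l) (t l) (br l.+1)) /\
    lie_iso_comm h0 (br s) (lie_alg O').
Proof.
move=> bU _ cvO'.
pose S n := (invmx (b n))^T *m Jpq R (p + q) p *m invmx (b n).
have [sigma [sinc [eps [e [P [Q [P0 [Q0 [le nf]]]]]]]]] := @exists_normal_form _ _ S
  (fun n => pullback_sym p (b n)) (fun n => pullback_unit p (bU n)).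
have {}cvO' := geom_cvg_subsequence sinc
  (fun n => ex_intro _ _ (conj_POpq_1 p (bU n))) cvO'.
have O'E : lie_alg O' = conj_pre P0 Q0 (limit_alg eps le).
  apply/seteqP; split=> X.
    by apply: (lie_alg_limit_sub nf) cvO' X => n A; exact: conj_POpq_similitude.
  by apply: (lie_alg_limit_sup nf) cvO' X => n A; exact: conj_POpq_isometry.
(* The signs are the same for all n, so the congruence at index 0 already gives po(p,q) with the
   signs of the limit. *)
have [F [G [GF h0E]]] := so_diag_congruent (bU (sigma 0)) (nf_gt0 nf 0) (nf_inv nf 0)
  (nf_form nf 0).
have FG := mulmx1C GF.
(* The default value is never reached, since the contractions are indexed by l < p + q. *)
pose cut l i := if insub l is Some l' then le i (l' : 'I_(p + q)) else true.
exists (p + q)%N, (fun l => conj_br F G (partial_comm (cuts_chi le l))),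
  (fun l => conj_pre F G (cut_subalg eps (cut l))).
rewrite /= h0E O'E; split.
  move=> X Y _ _; rewrite /conj_br.
  (* Before any cut every k is allowed, so the bracket is the full commutator. *)
  have -> : partial_comm (cuts_chi le 0) (G *m X *m F) (G *m Y *m F) =
      G *m comm X Y *m F.
    transitivity (comm (G *m X *m F) (G *m Y *m F)).
      apply/matrixP => i j; rewrite !mxE -sumrB; apply: eq_bigl => k.
      exact: cuts_chi0.
    rewrite /comm -!mulmxE mulmxBr mulmxBl !mulmxA.
    by rewrite -(mulmxA _ F G) FG mulmx1 -(mulmxA _ F G) FG mulmx1.
  by rewrite !mulmxA FG mul1mx -mulmxA FG mulmx1.
split=> [l lm|]; last first.
  apply: lie_iso_comm_conjl => //; apply: lie_iso_comm_conjr.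
    exact: normal_form_inv nf.
  exact: (limit_alg_iso (nf_sign nf) (nf_total nf) (nf_trans nf)).
have chiC := cuts_chiC le l.
split; first by apply: lie_subalg_conj => //; exact: (cut_lie_subalg (nf_sign nf) _ chiC).
apply: lie_contraction_conj => //.
have -> : partial_comm (R := R) (cuts_chi le l.+1) =
    partial_comm (cut_chi (cuts_chi le l) (cut l)).
  congr partial_comm; apply/funext => i; apply/funext => k; apply/funext => j.
  by rewrite (cuts_chiS le (Ordinal lm)) /cut_chi /cut insubT.
exact: (cut_contraction eps _ chiC).
Qed.
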